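(* Let $n,m,\hbar\in\mathbb{N}^+$, $A\in\mathbb{R}^{n\times n}$ and $\{B_k\}_{k=1}^{\hbar}\subset\mathbb{R}^{n\times m}$ be given. The following statements are equivalent: (i) The pair $(A,\{B_k\}_{k=1}^{\hbar})$ is $\hbar$-stabilizable. (ii) For any $\lambda\in\mathbb{C}^+$, $\mathrm{Rank}\,(\lambda\mathbb{I}_n-A,B_1,\cdots,B_\hbar)=n$. (iii) For any $\lambda\in\sigma(A)\cap\mathbb{C}^+$, $\mathrm{Rank}\,(\lambda\mathbb{I}_n-A,B_1,\cdots,B_\hbar)=n$.
   Context: $\mathbb{N}=\{0,1,2,\dots\}$, $\mathbb{N}^+=\{1,2,\dots\}$, $\mathbb{R}^+=[0,\infty)$, $\mathbb{C}^+:=\{z\in\mathbb{C}:\mathrm{Re}\,z\ge 0\}$; $\sigma(A)$ is the spectrum of $A$; $\mathbb{I}_n$ is the $n\times n$ identity. $\mathfrak{I}_\hbar$ is the set of all sequences $\Lambda_\hbar=\{t_j\}_{j\in\mathbb{N}}$ with $t_0=0<t_1<t_2<\cdots$ and $t_{j+\hbar}-t_j=t_\hbar$ for all $j\in\mathbb{N}^+$. For $s>0$ let $[s]:=\max\{k\in\mathbb{N}:k<s\}$, and for $j\in\mathbb{N}^+$ let $\vartheta(j):=j-[j/\hbar]\hbar\in\{1,\dots,\hbar\}$. For $\Lambda_\hbar\in\mathfrak{I}_\hbar$, the system $(A,\{B_k\}_{k=1}^{\hbar},\Lambda_\hbar)$ is $$x'(t)=Ax(t),\ t\in\mathbb{R}^+\setminus\Lambda_\hbar;\qquad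 \triangle x(t_j)=B_{\vartheta(j)}u_j,\ j\in\mathbb{N}^+,$$ where $\triangle x(t_j):=x(t_j^+)-x(t_j)$, $u_j\in\mathbb{R}^m$, and solutions are left continuous on $\mathbb{R}^+$ and continuous off $\{t_j\}_{j\in\mathbb{N}^+}$. It is $\hbar$-stabilizable if there is $\{F_k\}_{k=1}^{\hbar}\subset\mathbb{R}^{m\times n}$ such that the closed-loop system $$x'(t)=Ax(t),\ t\in\mathbb{R}^+\setminus\Lambda_\hbar;\qquad \triangle x(t_j)=B_{\vartheta(j)}F_{\vartheta(j)}x(t_j),\ j\in\mathbb{N}^+,$$ is stable, i.e. there are $M>0$, $\mu>0$ such that every solution satisfies $\|x(t)\|\le Me^{-\mu t}\|x(0)\|$ for all $t\in\mathbb{R}^+$. The pair $(A,\{B_k\}_{k=1}^{\hbar})$ is $\hbar$-stabilizable if there is $\Lambda_\hbar\in\mathfrak{I}_\hbar$ such that the system $(A,\{B_k\}_{k=1}^{\hbar},\Lambda_\hbar)$ is $\hbar$-stabilizable. *)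

(* Defs.v *)
From HB Require Import structures.
From mathcomp Require Import all_boot all_order all_algebra.
From mathcomp Require Import all_classical all_reals all_analysis.
From mathcomp Require Import complex.

Set Implicit Arguments.
Unset Strict Implicit.
Unset Printing Implicit Defensive.

Import Order.TTheory GRing.Theory Num.Theory.
Import numFieldNormedType.Exports.

Local Open Scope classical_set_scope.
Local Open Scope ring_scope.

(* [j / h], where [s] := max {k in N | k < s}; the condition k < j / h is
   cleared of its denominator, and forces k < j when 0 < h. *)
Definition quot_lt (h j : nat) : nat := (\max_(k < j | (k * h < j)%N) k)%N.

(* Takes its values in {1, ..., h} for 0 < j and 0 < h (see [thetaE]). *)
Definition theta (h j : nat) : nat := (j - quot_lt h j * h)%N.

Lemma quot_ltE (h j : nat) : (0 < h)%N -> (0 < j)%N ->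
  quot_lt h j = (j.-1 %/ h)%N.
Proof.
move=> h0 j0; apply/eqP; rewrite eqn_leq; apply/andP; split.
  by apply/bigmax_leqP => k kj; rewrite leq_divRL// -ltnS prednK.
have qj : (j.-1 %/ h < j)%N.
  by rewrite -[X in (_ < X)%N](prednK j0) ltnS leq_div.
apply: (@leq_bigmax_cond _ (fun k : 'I_j => (k * h < j)%N)
  (fun k : 'I_j => k : nat) (Ordinal qj)).
by rewrite /= -[X in (_ < X)%N](prednK j0) ltnS leq_divM.
Qed.

Lemma thetaE (h j : nat) : (0 < h)%N -> (0 < j)%N ->
  theta h j = (j.-1 %% h).+1.
Proof.
move=> h0 j0; rewrite /theta quot_ltE//.
rewrite -{1}(prednK j0) {1}(divn_eq j.-1 h) -addnS.
by rewrite addnC addnK.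
Qed.

Section Systems.
Variables (R : realType) (n m hbar : nat).
Implicit Types (A : 'M[R]_n) (B : 'I_hbar -> 'M[R]_(n, m)).
Implicit Types (F : 'I_hbar -> 'M[R]_(m, n)).
Implicit Types (tau : nat -> R) (x : R -> 'cV[R]_n).

(* The library norm on matrices is the sup norm. *)
Definition euclidean_norm (v : 'cV[R]_n) : R :=
  Num.sqrt (\sum_(i < n) v i ord0 ^+ 2).

Definition impulse_instants tau : Prop :=
  [/\ tau 0%N = 0,
      forall j : nat, tau j < tau j.+1 &
      forall j : nat, (0 < j)%N -> tau (j + hbar)%N - tau j = tau hbar].

(* A trajectory on [0, +oo[ is represented by a function on R, of which only
   the values at nonnegative times are constrained.  The families B_1, ...,
   B_hbar and F_1, ..., F_hbar are indexed by 'I_hbar, so that B_theta(j) is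
   [B k] for the ordinal k such that theta(j) = k + 1.  The last condition says
   that x(t_j^+) exists and x(t_j^+) - x(t_j) = B_theta(j) F_theta(j) x(t_j). *)
Definition closed_loop_solution A B tau F x : Prop :=
  [/\ forall t : R, 0 <= t -> (forall j : nat, t != tau j) ->
        is_derive t (1 : R) x (A *m x t),
      forall t : R, 0 < t -> x s @[s --> t^'-] --> x t,
      forall t : R, 0 <= t -> (forall j : nat, (0 < j)%N -> t != tau j) ->
        x s @[s --> within [set s : R | 0 <= s] (nbhs t)] --> x t &
      forall (j : nat) (k : 'I_hbar), (0 < j)%N -> theta hbar j = k.+1 ->
        x s - x (tau j) @[s --> (tau j)^'+] -->
          B k *m (F k *m x (tau j))].

Definition closed_loop_stable A B tau F : Prop :=
  exists M mu : R, [/\ 0 < M, 0 < mu &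
    forall x, closed_loop_solution A B tau F x ->
    forall t : R, 0 <= t ->
      euclidean_norm (x t) <= M * expR (- mu * t) * euclidean_norm (x 0)].

Definition system_stabilizable A B tau : Prop :=
  exists F, closed_loop_stable A B tau F.

Definition pair_stabilizable A B : Prop :=
  exists tau, impulse_instants tau /\ system_stabilizable A B tau.

Definition complexify (p q : nat) (P : 'M[R]_(p, q)) : 'M[R[i]]_(p, q) :=
  map_mx (real_complex R) P.

Definition spectrum A : set R[i] :=
  [set lambda | eigenvalue (complexify A) lambda].

Definition closed_right_half_plane : set R[i] :=
  [set z | 0 <= complex.Re z].

Definition hautus_matrix A B (lambda : R[i]) :
    'M[R[i]]_(n, n + \sum_(k < hbar) m) :=
  row_mx (lambda%:M - complexify A) (\mxrow_(k < hbar) complexify (B k)).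

End Systems.

Arguments closed_right_half_plane {R}.

(* Main.v *)
Require Import Defs.
From mathcomp Require Import all_boot all_order all_algebra.
From mathcomp Require Import all_classical all_reals all_analysis.
From mathcomp Require Import complex.
From mathcomp Require Import spectral.
From mathcomp Require Import ring lra zify.

Set Implicit Arguments.
Unset Strict Implicit.
Unset Printing Implicit Defensive.

Import Order.TTheory GRing.Theory Num.Theory.
Import numFieldNormedType.Exports.

Local Open Scope classical_set_scope.
Local Open Scope ring_scope.

(** Both implications rest on hidden modes: complex row vectors v <> 0 with
    v A = lambda v and v B_k = 0 for all k.  By [hautus_rankP] they are exactly
    what makes the rank at lambda drop.

    Necessity.  If Re lambda >= 0, the quantity |v x(t)|^2 does not decrease
    along the free motion and does not change at the impulses, so it cannot tend
    to 0 along a closed-loop solution unless v x(0) = 0 ([stable_mode_eq0]).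
    Every x(0) is the initial state of a solution, which is built piecewise from
    the matrix exponential ([loop_traj_solution]), hence v = 0.

    Sufficiency.  The instants are t_j = j d, and d > 0 has to be chosen so that
    sampling loses no controllability.  Call a linear form undetected if it
    annihilates all exp (- j d A) B_(theta(j + 1)) and all the states that decay
    without control.  Refining the step by the factor hbar + 1 keeps the phases
    and shrinks the space of undetected forms; once its dimension is minimal, it
    is invariant under exp (- T A) for arbitrarily small T > 0, hence under A.
    If it is not zero, it yields a hidden mode that annihilates all the decaying
    states.  The Cayley-Hamilton theorem forces its eigenvalue to satisfy
    Re lambda >= 0 ([eigen_kills_decaying]), which the rank condition excludes.
    So some d leaves no nonzero undetected form ([exists_sampling]).

    For this d every state has a control of finite quadratic cost
    ([all_finite_cost]): the states of finite cost form a subspace that contains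
    the decaying states and the ranges of all exp (- j d A) B_(theta(j + 1)).
    The optimal costs over N periods, computed by the Riccati recursion, are
    then bounded and nondecreasing in N, so that for some N one more period adds
    at most |x|^2 / 2.  The optimal feedback over the first of these N + 1
    periods makes the optimal cost over N periods a Lyapunov function
    ([discrete_stabilization]).  Gronwall's inequality carries the resulting
    geometric decay over to all times ([closed_loop_stable_sampled]). *)

(** * Gronwall's inequality *)

Section ScalarInequalities.
Variable R : realType.
Implicit Types f df : R -> R.

Lemma nonincr_segment f df (a b : R) : a <= b ->
  {within `[a, b], continuous f} ->
  (forall t, t \in `]a, b[ -> is_derive t 1 f (df t)) ->
  (forall t, t \in `]a, b[ -> df t <= 0) -> f b <= f a.
Proof.
move=> ab fc fd fd0.
have abl : a \in `[a, b] by rewrite in_itv/= lexx.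
have abr : b \in `[a, b] by rewrite in_itv/= ab lexx.
apply: (@ler0_derive1_le_cc R f a b _ _ fc _ _ abr abl ab) => t tab.
- by case: (fd _ tab).
- by rewrite derive1E; case: (fd _ tab) => _ ->; exact: fd0.
Qed.

Lemma nondecr_segment f df (a b : R) : a <= b ->
  {within `[a, b], continuous f} ->
  (forall t, t \in `]a, b[ -> is_derive t 1 f (df t)) ->
  (forall t, t \in `]a, b[ -> 0 <= df t) -> f a <= f b.
Proof.
move=> ab fc fd fd0.
have abl : a \in `[a, b] by rewrite in_itv/= lexx.
have abr : b \in `[a, b] by rewrite in_itv/= ab lexx.
apply: (@ger0_derive1_le_cc R f a b _ _ fc _ _ abl abr ab) => t tab.
- by case: (fd _ tab).
- by rewrite derive1E; case: (fd _ tab) => _ ->; exact: fd0.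
Qed.

Lemma is_derive_expRZ (k t : R) :
  is_derive t 1 (fun s => expR (k * s)) (k * expR (k * t)).
Proof.
have h : is_derive t 1 (fun s : R => k * s) k.
  have := @is_deriveZ R R R (@id R) k t 1 1 (is_derive_id _ _).
  by rewrite -[X in is_derive _ _ _ X]/(k * 1) mulr1.
rewrite [X in is_derive _ _ _ X]mulrC.
exact: (@is_derive1_comp R expR (fun s => k * s) t _ _ (is_derive_expR _) h).
Qed.

Lemma continuous_expRZ (k : R) : continuous (fun s : R => expR (k * s)).
Proof.
move=> t; apply: differentiable_continuous; apply/derivable1_diffP.
by case: (is_derive_expRZ k t).
Qed.

Lemma within_continuousM f g (a b : R) :
  {within `[a, b], continuous f} -> {within `[a, b], continuous g} ->
  {within `[a, b], continuous (fun t => f t * g t)}.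
Proof. by move=> fc gc t; apply: cvgM; [exact: fc|exact: gc]. Qed.

Lemma within_continuousD f g (a b : R) :
  {within `[a, b], continuous f} -> {within `[a, b], continuous g} ->
  {within `[a, b], continuous (fun t => f t + g t)}.
Proof. by move=> fc gc t; apply: cvgD; [exact: fc|exact: gc]. Qed.

Lemma is_derive_bigsum (I : Type) (r : seq I) (h : I -> R -> R)
    (dh : I -> R) (t : R) :
  (forall i, is_derive t 1 (h i) (dh i)) ->
  is_derive t 1 (fun s => \sum_(i <- r) h i s) (\sum_(i <- r) dh i).
Proof.
move=> hd; elim: r => [|i r IH].
  rewrite big_nil (_ : (fun s => _) = cst 0); first exact: is_derive_cst.
  by apply/funext => s; rewrite big_nil.
rewrite big_cons (_ : (fun s => _) = h i \+ (fun s => \sum_(j <- r) h j s)).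
  exact: is_deriveD.
by apply/funext => s; rewrite big_cons.
Qed.

Lemma within_continuous_bigsum (I : Type) (r : seq I) (h : I -> R -> R)
    (a b : R) :
  (forall i, {within `[a, b], continuous (h i)}) ->
  {within `[a, b], continuous (fun t => \sum_(i <- r) h i t)}.
Proof.
move=> hc; elim: r => [|i r IH].
  rewrite (_ : (fun s => _) = cst 0); first by move=> t; exact: cvg_cst.
  by apply/funext => s; rewrite big_nil.
rewrite (_ : (fun s => _) = (fun s => h i s + \sum_(j <- r) h j s)).
  exact: within_continuousD.
by apply/funext => s; rewrite big_cons.
Qed.

(** Gronwall's inequality, forward in time. *)
Lemma gronwall_le f df (K a b : R) : a <= b ->
  {within `[a, b], continuous f} ->
  (forall t, t \in `]a, b[ -> is_derive t 1 f (df t)) ->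
  (forall t, t \in `]a, b[ -> df t <= K * f t) ->
  f b <= expR (K * (b - a)) * f a.
Proof.
move=> ab fc fd fK.
have : expR (- K * b) * f b <= expR (- K * a) * f a.
  apply: (@nonincr_segment (fun t => expR (- K * t) * f t)
    (fun t => expR (- K * t) * (df t - K * f t)) _ _ ab).
  - apply: within_continuousM fc.
    exact/continuous_subspaceT/continuous_expRZ.
  - move=> t tab; have := is_deriveM (is_derive_expRZ (- K) t) (fd t tab).
    move=> /is_derive_eq; apply; rewrite /GRing.scale/=; ring.
  - move=> t tab; rewrite pmulr_rle0 ?expR_gt0// subr_le0; exact: fK.
rewrite -(ler_pM2l (expR_gt0 (K * b))) !mulrA -!expRD.
by rewrite mulNr subrr expR0 mul1r mulNr -mulrBr.
Qed.

(** Gronwall's inequality, backward in time. *)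
Lemma gronwall_ge f df (K a b : R) : a <= b ->
  {within `[a, b], continuous f} ->
  (forall t, t \in `]a, b[ -> is_derive t 1 f (df t)) ->
  (forall t, t \in `]a, b[ -> - (K * f t) <= df t) ->
  f a <= expR (K * (b - a)) * f b.
Proof.
move=> ab fc fd fK.
have : expR (K * a) * f a <= expR (K * b) * f b.
  apply: (@nondecr_segment (fun t => expR (K * t) * f t)
    (fun t => expR (K * t) * (df t + K * f t)) _ _ ab).
  - apply: within_continuousM fc.
    exact/continuous_subspaceT/continuous_expRZ.
  - move=> t tab; have := is_deriveM (is_derive_expRZ K t) (fd t tab).
    move=> /is_derive_eq; apply; rewrite /GRing.scale/=; ring.
  - move=> t tab; rewrite pmulr_rge0 ?expR_gt0// -lerBlDr sub0r; exact: fK.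
rewrite -(ler_pM2l (expR_gt0 (K * - a))) !mulrA -!expRD.
by rewrite mulrN addNr expR0 mul1r mulrBr addrC.
Qed.

End ScalarInequalities.

(** * Solutions of linear differential equations *)

Section LinearFlows.
Variable R : realType.

(** The squared Euclidean (Frobenius) norm of a matrix. *)
Definition sqn (p q : nat) (X : 'M[R]_(p, q)) : R :=
  \sum_i \sum_j X i j ^+ 2.

Lemma sqn_ge0 p q (X : 'M[R]_(p, q)) : 0 <= sqn X.
Proof. by apply: sumr_ge0 => i _; apply: sumr_ge0 => j _; exact: sqr_ge0. Qed.

Lemma sqr_le_sqn p q (X : 'M[R]_(p, q)) i j : X i j ^+ 2 <= sqn X.
Proof.
rewrite /sqn (bigD1 i)//= (bigD1 j)//= -addrA lerDl addr_ge0//.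
  by apply: sumr_ge0 => *; exact: sqr_ge0.
by apply: sumr_ge0 => ? _; apply: sumr_ge0 => *; exact: sqr_ge0.
Qed.

Lemma sqn_eq0 p q (X : 'M[R]_(p, q)) : sqn X <= 0 -> X = 0.
Proof.
move=> X0; apply/matrixP => i j; rewrite mxE; apply/eqP.
by rewrite -sqrf_eq0 eq_le sqr_ge0 (le_trans (sqr_le_sqn X i j)).
Qed.

Lemma sqn0 p q : sqn (0 : 'M[R]_(p, q)) = 0.
Proof.
by rewrite /sqn big1// => i _; rewrite big1// => j _; rewrite mxE expr0n.
Qed.

Lemma sqnZ p q (a : R) (X : 'M[R]_(p, q)) : sqn (a *: X) = a ^+ 2 * sqn X.
Proof.
rewrite /sqn mulr_sumr; apply: eq_bigr => i _; rewrite mulr_sumr.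
by apply: eq_bigr => j _; rewrite mxE exprMn.
Qed.

Lemma sqnD p q (X Y : 'M[R]_(p, q)) : sqn (X + Y) <= 2 * sqn X + 2 * sqn Y.
Proof.
rewrite /sqn !mulr_sumr -big_split/=; apply: ler_sum => i _.
rewrite !mulr_sumr -big_split/=; apply: ler_sum => j _; rewrite mxE.
have := sqr_ge0 (X i j - Y i j); lra.
Qed.

Lemma euclidean_normE n (v : 'cV[R]_n) : euclidean_norm v ^+ 2 = sqn v.
Proof.
rewrite /euclidean_norm sqr_sqrtr; last by apply: sumr_ge0 => *; exact: sqr_ge0.
by apply: eq_bigr => i _; rewrite big_ord1.
Qed.

(** The sum of the absolute values of the entries of A. *)
Definition mxbound n p (A : 'M[R]_(n, p)) : R := \sum_i \sum_j `|A i j|.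

Lemma mxbound_ge0 n p (A : 'M[R]_(n, p)) : 0 <= mxbound A.
Proof. by apply: sumr_ge0 => i _; apply: sumr_ge0. Qed.

Lemma ler_mxbound n p (A : 'M[R]_(n, p)) i j : `|A i j| <= mxbound A.
Proof.
rewrite /mxbound (bigD1 i)//= (bigD1 j)//= -addrA lerDl addr_ge0//.
  by apply: sumr_ge0.
by apply: sumr_ge0 => ? _; apply: sumr_ge0.
Qed.

(** A crude bound for the rate at which |X|^2 can vary along X' = A X, see
    [dot_mulmx_le]. *)
Definition flow_rate n (A : 'M[R]_n) : R := n%:R * mxbound A *+ 2.

Lemma flow_rate_ge0 n (A : 'M[R]_n) : 0 <= flow_rate A.
Proof. by rewrite mulrn_wge0// mulr_ge0// mxbound_ge0. Qed.

Lemma dot_mulmx_le n p (A : 'M[R]_n) (X : 'M[R]_(n, p)) :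
  `|\sum_i \sum_j 2 * X i j * (A *m X) i j| <= flow_rate A * sqn X.
Proof.
pose S := \sum_(i < n) \sum_(j < p) \sum_(l < n)
  mxbound A * (X i j ^+ 2 + X l j ^+ 2).
have -> : flow_rate A * sqn X = S.
  have -> : S = mxbound A * \sum_(i < n) \sum_(j < p)
      (X i j ^+ 2 *+ n + \sum_(l < n) X l j ^+ 2).
    rewrite /S mulr_sumr; apply: eq_bigr => i _; rewrite mulr_sumr.
    apply: eq_bigr => j _; rewrite -mulr_sumr big_split/=.
    by rewrite sumr_const card_ord.
  under eq_bigr do rewrite big_split/=.
  rewrite big_split/= sumr_const card_ord [in X in _ + X *+ _]exchange_big/=.
  under eq_bigr do rewrite sumrMnl.
  rewrite sumrMnl /flow_rate -/(sqn X) -[sqn X *+ n]mulr_natl.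
  by move: (n%:R) (mxbound A) (sqn X) => *; ring.
rewrite /S; apply: le_trans (ler_norm_sum _ _ _) _; apply: ler_sum => i _.
apply: le_trans (ler_norm_sum _ _ _) _; apply: ler_sum => j _.
rewrite mxE mulr_sumr.
apply: le_trans (ler_norm_sum _ _ _) _; apply: ler_sum => l _.
rewrite (_ : _ * _ = A i l * (2 * X i j * X l j)); last by ring.
rewrite normrM ler_pM// ?ler_mxbound//.
rewrite ler_norml; apply/andP; split.
  by have := sqr_ge0 (X i j + X l j); lra.
by have := sqr_ge0 (X i j - X l j); lra.
Qed.

(** [lin_flow A X a b]: the matrix-valued function X is continuous on [a, b] and
    solves X' = A X on the open interval. *)
Definition lin_flow n p (A : 'M[R]_n) (X : R -> 'M[R]_(n, p)) (a b : R) :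
    Prop :=
  forall i j, {within `[a, b], continuous (fun t => X t i j)} /\
    forall t, t \in `]a, b[ ->
      is_derive t 1 (fun s => X s i j) ((A *m X t) i j).

Lemma sqn_flow n p (A : 'M[R]_n) (X : R -> 'M[R]_(n, p)) (a b : R) :
  lin_flow A X a b ->
  {within `[a, b], continuous (fun t => sqn (X t))} /\
  forall t, t \in `]a, b[ -> is_derive t 1 (fun s => sqn (X s))
    (\sum_i \sum_j 2 * X t i j * (A *m X t) i j).
Proof.
move=> XA; split.
  apply: within_continuous_bigsum => i; apply: within_continuous_bigsum => j.
  by apply: within_continuousM; case: (XA i j).
move=> t tab; apply: is_derive_bigsum => i; apply: is_derive_bigsum => j.
have d := (XA i j).2 _ tab.
have := is_deriveM d d => /is_derive_eq; apply.
by rewrite /GRing.scale/=; ring.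
Qed.

Lemma flow_le n p (A : 'M[R]_n) (X : R -> 'M[R]_(n, p)) (a b : R) : a <= b ->
  lin_flow A X a b -> sqn (X b) <= expR (flow_rate A * (b - a)) * sqn (X a).
Proof.
move=> ab XA; have [c d] := sqn_flow XA.
apply: (gronwall_le ab c d) => t tab.
exact: le_trans (ler_norm _) (dot_mulmx_le _ _).
Qed.

Lemma flow_ge n p (A : 'M[R]_n) (X : R -> 'M[R]_(n, p)) (a b : R) : a <= b ->
  lin_flow A X a b -> sqn (X a) <= expR (flow_rate A * (b - a)) * sqn (X b).
Proof.
move=> ab XA; have [c d] := sqn_flow XA.
apply: (gronwall_ge ab c d) => t tab.
by rewrite lerNl (le_trans _ (dot_mulmx_le _ _))// -normrN ler_norm.
Qed.

Lemma lin_flowB n p (A : 'M[R]_n) (X Y : R -> 'M[R]_(n, p)) (a b : R) :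
  lin_flow A X a b -> lin_flow A Y a b -> lin_flow A (fun t => X t - Y t) a b.
Proof.
move=> XA YA i j; have [xc xd] := XA i j; have [yc yd] := YA i j.
rewrite (_ : (fun t => (X t - Y t) i j) =
    (fun t => X t i j) \- (fun t => Y t i j));
  last by apply/funext => t; rewrite !mxE.
split=> [t|t tab]; first by apply: cvgB; [exact: xc|exact: yc].
rewrite mulmxBr (_ : (A *m X t - A *m Y t) i j =
    (A *m X t) i j - (A *m Y t) i j).
  exact: is_deriveB (xd t tab) (yd t tab).
by rewrite !mxE.
Qed.

(** Solutions of X' = A X on a segment are determined by their value at one
    endpoint. *)
Lemma flow_unique n p (A : 'M[R]_n) (X Y : R -> 'M[R]_(n, p)) (a b : R) :
  a <= b -> lin_flow A X a b -> lin_flow A Y a b -> X a = Y a -> X b = Y b.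
Proof.
move=> ab XA YA XYa; apply/eqP; rewrite -subr_eq0; apply/eqP/sqn_eq0.
by have := flow_le ab (lin_flowB XA YA); rewrite XYa subrr sqn0 mulr0.
Qed.

Lemma flow_unique_rev n p (A : 'M[R]_n) (X Y : R -> 'M[R]_(n, p)) (a b : R) :
  a <= b -> lin_flow A X a b -> lin_flow A Y a b -> X b = Y b -> X a = Y a.
Proof.
move=> ab XA YA XYb; apply/eqP; rewrite -subr_eq0; apply/eqP/sqn_eq0.
by have := flow_ge ab (lin_flowB XA YA); rewrite XYb subrr sqn0 mulr0.
Qed.

Lemma lin_flow_global n p (A : 'M[R]_n) (X : R -> 'M[R]_(n, p)) :
  (forall (t : R) i j, is_derive t 1 (fun s => X s i j) ((A *m X t) i j)) ->
  forall a b, lin_flow A X a b.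
Proof.
move=> Xd a b i j; split; last by move=> t _; exact: Xd.
by apply: derivable_within_continuous => t _; case: (Xd t i j).
Qed.

End LinearFlows.

(** * The matrix exponential *)

Section MatrixExponential.
Variable R : realType.

(** Exponential generating functions of sequences with at most geometric
    growth converge everywhere. *)
Lemma cvg_egf (a : nat -> R) (D K x : R) : 0 <= K ->
  (forall k, `|a k| <= D * K ^+ k) ->
  cvgn (pseries (fun k => a k / k`!%:R) x).
Proof.
move=> K0 aK; apply: normed_cvg; rewrite /normed_series_of /=.
apply: (@series_le_cvg _ _ (fun k => D * exp_coeff (K * `|x|) k)) => [k|k|k|].
- by [].
- have D0 : 0 <= D.
    by rewrite (le_trans (normr_ge0 _) (le_trans (aK 0%N) _))// expr0 mulr1.
  by rewrite mulr_ge0// exp_coeff_ge0// mulr_ge0.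
- rewrite /exp_coeff/= 2!normrM normrX normfV [`|k`!%:R|]ger0_norm// exprMn.
  rewrite mulrA mulrA mulrAC ler_wpM2r ?invr_ge0// ler_wpM2r ?exprn_ge0//.
- exact/is_cvg_seriesZ/is_cvg_series_exp_coeff.
Qed.

(** Differentiating an exponential generating function shifts its
    coefficients. *)
Lemma is_derive_egf (a : nat -> R) (D K x : R) : 0 <= K ->
  (forall k, `|a k| <= D * K ^+ k) ->
  is_derive x 1 (fun s => limn (pseries (fun k => a k / k`!%:R) s))
    (limn (pseries (fun k => a k.+1 / k`!%:R) x)).
Proof.
move=> K0 aK.
have diffsE (b : nat -> R) :
    pseries_diffs (fun k => b k / k`!%:R) = (fun k => b k.+1 / k`!%:R).
  apply/funext => k; rewrite /pseries_diffs factS natrM invfM mulrCA.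
  by congr (_ * _); rewrite mulrA divff ?mul1r// pnatr_eq0.
have step (b : nat -> R) D' : (forall k, `|b k| <= D' * K ^+ k) ->
    forall k, `|b k.+1| <= (D' * K) * K ^+ k.
  by move=> bK k; rewrite (le_trans (bK _))// exprS mulrA.
rewrite -diffsE; apply: (@pseries_snd_diffs _ _ (`|x| + 1)).
- exact: cvg_egf aK.
- rewrite diffsE; exact: cvg_egf (step _ _ aK).
- rewrite diffsE (diffsE (fun k => a k.+1)).
  exact: cvg_egf (step _ _ (step _ _ aK)).
- by rewrite [ltRHS]ger0_norm ?addr_ge0// ltrDl.
Qed.

Variable n : nat.
Implicit Types A : 'M[R]_n.

(** The power A ^ k, for square matrices of any size, including 0. *)
Definition mxpow A k : 'M[R]_n := iter k (mulmx A) 1%:M.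

Lemma mxpow_bound A k i j : `|mxpow A k i j| <= 1 * mxbound A ^+ k.
Proof.
rewrite mul1r; elim: k i j => [|k IH] i j.
  by rewrite /= expr0 mxE; case: eqP => _; rewrite ?normr1 ?normr0.
rewrite /= mxE exprS; apply: le_trans (ler_norm_sum _ _ _) _.
apply: (@le_trans _ _ (\sum_l `|A i l| * mxbound A ^+ k)).
  by apply: ler_sum => l _; rewrite normrM ler_wpM2l.
rewrite -mulr_suml ler_wpM2r ?exprn_ge0 ?mxbound_ge0//.
rewrite /mxbound [leRHS](bigD1 i)//= lerDl; apply: sumr_ge0 => *.
by apply: sumr_ge0.
Qed.

(** The matrix exponential t |-> exp (t A), defined entrywise by its power
    series. *)
Definition expmx A (t : R) : 'M[R]_n :=
  \matrix_(i, j) limn (pseries (fun k => mxpow A k i j / k`!%:R) t).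

Lemma expmx0 A : expmx A 0 = 1%:M.
Proof.
apply/matrixP => i j; rewrite mxE.
apply: cvg_lim => //; rewrite -cvg_shiftS.
rewrite (_ : (fun _ => _) = cst ((1%:M : 'M[R]_n) i j)); first exact: cvg_cst.
apply/funext => N; rewrite /pseries /series /= big_nat_recl//= big1.
  by rewrite expr0 mulr1 fact0 invr1 mulr1 addr0.
by move=> k _; rewrite expr0n/= mulr0.
Qed.

Lemma cvg_bigsum (I : Type) (r : seq I) (u : I -> nat -> R) (l : I -> R) :
  (forall i, u i @ \oo --> l i) ->
  (fun N => \sum_(i <- r) u i N) @ \oo --> \sum_(i <- r) l i.
Proof.
move=> ul; elim: r => [|i r IH].
  rewrite big_nil (_ : (fun N => _) = cst 0); first exact: cvg_cst.
  by apply/funext => s; rewrite big_nil.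
rewrite big_cons (_ : (fun N => _) = (fun N => u i N + \sum_(j <- r) u j N)).
  exact: cvgD.
by apply/funext => s; rewrite big_cons.
Qed.

Lemma is_derive_expmx A (t : R) i j :
  is_derive t 1 (fun s => expmx A s i j) ((A *m expmx A t) i j).
Proof.
rewrite (_ : (fun s => _) =
    (fun s => limn (pseries (fun k => mxpow A k i j / k`!%:R) s))); last first.
  by apply/funext => s; rewrite mxE.
rewrite (_ : (A *m expmx A t) i j =
    limn (pseries (fun k => mxpow A k.+1 i j / k`!%:R) t)).
  exact: is_derive_egf (mxbound_ge0 A) (fun k => mxpow_bound A k i j).
apply/esym/cvg_lim => //.
rewrite (_ : pseries _ _ = (fun N => \sum_l A i l *
    pseries (fun k => mxpow A k l j / k`!%:R) t N)).
  rewrite mxE; apply: cvg_bigsum => l; rewrite mxE; apply: cvgMr.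
  exact: cvg_egf (mxbound_ge0 A) (fun k => mxpow_bound A k l j).
apply/funext => N; rewrite /pseries/series/=.
under [RHS]eq_bigr do rewrite mulr_sumr.
rewrite [RHS]exchange_big/=; apply: eq_bigr => k _.
by rewrite mxE !mulr_suml; apply: eq_bigr => l _; rewrite !mulrA.
Qed.

End MatrixExponential.

Section MatrixExponentialTheory.
Variable R : realType.

Lemma is_derive_translate (f : R -> R) (a t d : R) :
  is_derive (t + a) 1 f d -> is_derive t 1 (fun s => f (s + a)) d.
Proof.
move=> fd; rewrite -[d]mulr1.
by apply: (@is_derive1_comp R f (shift a) t d 1 fd); exact: is_derive_shift.
Qed.

Lemma is_derive_mulmx_cst (p q r s : nat) (M : 'M[R]_(p, q))
    (X : R -> 'M[R]_(q, r)) (dX : 'M[R]_(q, r)) (C : 'M[R]_(r, s)) (t : R) :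
  (forall i j, is_derive t 1 (fun u => X u i j) (dX i j)) ->
  forall i j, is_derive t 1 (fun u => (M *m X u *m C) i j) ((M *m dX *m C) i j).
Proof.
move=> Xd i j.
rewrite (_ : (fun u => _) = (fun u => \sum_l (\sum_k M i k * X u k l) * C l j));
  last by apply/funext => u; rewrite mxE; apply: eq_bigr => l _; rewrite mxE.
rewrite (_ : (M *m dX *m C) i j = \sum_l (\sum_k M i k * dX k l) * C l j);
  last by rewrite mxE; apply: eq_bigr => l _; rewrite mxE.
apply: is_derive_bigsum => l.
rewrite mulrC (_ : (fun u => _) = C l j \*: (fun u => \sum_k M i k * X u k l));
  last by apply/funext => u; rewrite mulrC.
by apply: is_deriveZ; apply: is_derive_bigsum => k.
Qed.

Lemma global_flow_unique n p (A : 'M[R]_n) (X Y : R -> 'M[R]_(n, p)) (a : R) :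
  (forall b c, lin_flow A X b c) -> (forall b c, lin_flow A Y b c) ->
  X a = Y a -> forall b, X b = Y b.
Proof.
move=> XA YA XYa b; have [ab|/ltW ba] := leP a b.
  exact: (flow_unique ab (XA _ _) (YA _ _)).
exact: (flow_unique_rev ba (XA _ _) (YA _ _)).
Qed.

Lemma flow_expmx_shift n p (A : 'M[R]_n) (C : 'M[R]_(n, p)) s a b :
  lin_flow A (fun t => expmx A (t + s) *m C) a b.
Proof.
apply: lin_flow_global => t i j.
rewrite (_ : (fun u => _) = (fun u => (1%:M *m expmx A (u + s) *m C) i j));
  last by apply/funext => u; rewrite mul1mx.
rewrite mulmxA -[A *m _]mul1mx; apply: is_derive_mulmx_cst => k l.
exact/(is_derive_translate (f := fun u => expmx A u k l))/is_derive_expmx.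
Qed.

(** Both sides solve X' = Y X with the initial value M. *)
Lemma expmx_intertwine n q (A : 'M[R]_n) (Y : 'M[R]_q) (M : 'M[R]_(q, n)) t :
  M *m A = Y *m M -> M *m expmx A t = expmx Y t *m M.
Proof.
move=> MA.
apply: (@global_flow_unique q n Y (fun s => M *m expmx A s)
  (fun s => expmx Y s *m M) 0).
- apply: lin_flow_global => s i j.
  rewrite (_ : (fun u => _) = (fun u => (M *m expmx A u *m 1%:M) i j));
    last by apply/funext => u; rewrite mulmx1.
  rewrite mulmxA -MA -mulmxA -[M *m _]mulmx1; apply: is_derive_mulmx_cst => k l.
  exact: is_derive_expmx.
- move=> b c; rewrite (_ : (fun s => _) = (fun s => expmx Y (s + 0) *m M)).
    exact: flow_expmx_shift.
  by apply/funext => s; rewrite addr0.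
- by rewrite !expmx0 mul1mx mulmx1.
Qed.

Variables (n : nat) (A : 'M[R]_n).

Lemma expmxC t : A *m expmx A t = expmx A t *m A.
Proof. exact: expmx_intertwine. Qed.

Lemma expmxD s t : expmx A (s + t) = expmx A s *m expmx A t.
Proof.
apply: (@global_flow_unique n n A (fun s => expmx A (s + t))
  (fun s => expmx A s *m expmx A t) 0).
- move=> b c; rewrite (_ : (fun s => _) = (fun s => expmx A (s + t) *m 1%:M)).
    exact: flow_expmx_shift.
  by apply/funext => u; rewrite mulmx1.
- move=> b c.
  rewrite (_ : (fun s => _) = (fun s => expmx A (s + 0) *m expmx A t)).
    exact: flow_expmx_shift.
  by apply/funext => u; rewrite addr0.
- by rewrite add0r expmx0 mul1mx.
Qed.

Lemma expmxKN t : expmx A t *m expmx A (- t) = 1%:M.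
Proof. by rewrite -expmxD subrr expmx0. Qed.

(** A solution on [a, b] is given by the matrix exponential. *)
Lemma flow_expmxE p (X : R -> 'M[R]_(n, p)) (a b : R) : a <= b ->
  lin_flow A X a b -> X b = expmx A (b - a) *m X a.
Proof.
move=> ab XA.
apply: (flow_unique ab XA (@flow_expmx_shift n p A (X a) (- a) a b)).
by rewrite subrr expmx0 mul1mx.
Qed.

Lemma sqn_expmx_le p (C : 'M[R]_(n, p)) t : 0 <= t ->
  sqn (expmx A t *m C) <= expR (flow_rate A * t) * sqn C.
Proof.
move=> t0; have := flow_le t0 (@flow_expmx_shift n p A C 0 0 t).
by rewrite !addr0 subr0 expmx0 mul1mx.
Qed.

(** The derivative of s |-> v exp (s A) x at 0 is v A x, so it vanishes as soon
    as the function vanishes at 0 and along some sequence tending to 0. *)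
Lemma expmx_generator (v : 'rV[R]_n) (x : 'cV[R]_n) (T : nat -> R) :
  T @ \oo --> (0 : R) -> (forall i, T i != 0) ->
  v *m x = 0 -> (forall i, v *m expmx A (T i) *m x = 0) ->
  v *m A *m x = 0.
Proof.
move=> T0 Tn0 vx0 vTx.
pose f (s : R) : R := (v *m expmx A s *m x) ord0 ord0.
have fd : is_derive (0 : R) 1 f ((v *m A *m x) ord0 ord0).
  have := @is_derive_mulmx_cst 1 n n 1 v (expmx A) (A *m expmx A 0) x 0.
  rewrite expmx0 mulmx1 => /(_ _ ord0 ord0); apply => i j.
  by have := is_derive_expmx A 0 i j; rewrite expmx0 mulmx1.
have Td : T @ \oo --> (0 : R)^'.
  move=> P [e /= e0 eP].
  have : \forall i \near \oo, ball (0 : R) e (T i).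
    exact: (T0 _ (nbhsx_ballx (0 : R) e e0)).
  by apply: filterS => i Ti; apply: eP => //=; rewrite Tn0.
have [fdd fdE] := fd.
have : (fun i => (T i)^-1 *: (f (T i *: 1 + 0) - f 0)) @ \oo -->
    (v *m A *m x) ord0 ord0.
  rewrite -fdE.
  exact: (cvg_comp T (fun h => h^-1 *: (f (h *: 1 + 0) - f 0)) Td fdd).
rewrite (_ : (fun i => _) = cst 0) => [/cvg_unique /(_ (cvg_cst 0)) vAx|].
  by apply/matrixP => i j; rewrite !ord1 [LHS]vAx// mxE.
apply/funext => i; rewrite addr0 [_ *: 1]mulr1 /f vTx.
by rewrite expmx0 mulmx1 vx0 !mxE subrr [_ *: _]mulr0.
Qed.

End MatrixExponentialTheory.

(** * Matrix-valued functions of a real variable *)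

Section Auxiliary.
Variable R : realType.

Lemma is_derive_mx (p q : nat) (X : R -> 'M[R]_(p, q)) (dX : 'M[R]_(p, q))
    (t : R) :
  (forall i j, is_derive t 1 (fun s => X s i j) (dX i j)) -> is_derive t 1 X dX.
Proof.
move=> Xd; have Xt : derivable X t 1.
  by apply/derivable_mxP => i j; case: (Xd i j).
apply: DeriveDef => //; rewrite derive_mx//; apply/matrixP => i j; rewrite mxE.
by case: (Xd i j).
Qed.

Lemma is_derive_coord (p q : nat) (X : R -> 'M[R]_(p, q)) (dX : 'M[R]_(p, q))
    (t : R) :
  is_derive t 1 X dX -> forall i j, is_derive t 1 (fun s => X s i j) (dX i j).
Proof.
move=> [Xd XdE] i j; apply: DeriveDef; first exact: (derivable_mxP X t 1).1.
by rewrite -XdE derive_mx// mxE.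
Qed.

Lemma continuous_expmx_mul n p (A : 'M[R]_n) (C : 'M[R]_(n, p)) :
  continuous (fun t => expmx A t *m C).
Proof.
move=> t; apply: differentiable_continuous; apply/derivable1_diffP.
apply/derivable_mxP => i j.
rewrite (_ : (fun u => _) = (fun u => (1%:M *m expmx A u *m C) i j));
  last by apply/funext => u; rewrite mul1mx.
have := @is_derive_mulmx_cst R n n n p 1%:M (expmx A) (A *m expmx A t) C t.
by move=> /(_ (fun k l => is_derive_expmx A t k l) i j) [].
Qed.

Lemma is_derive_expmx_mul n p (A : 'M[R]_n) (C : 'M[R]_(n, p)) (t : R) :
  is_derive t 1 (fun s => expmx A s *m C) (A *m (expmx A t *m C)).
Proof.
apply: is_derive_mx => i j.
rewrite (_ : (fun u => _) = (fun u => (1%:M *m expmx A u *m C) i j));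
  last by apply/funext => u; rewrite mul1mx.
rewrite mulmxA -[A *m _]mul1mx; apply: is_derive_mulmx_cst => k l.
exact: is_derive_expmx.
Qed.

Lemma cauchy_schwarz (I : finType) (a b : I -> R) :
  (\sum_i a i * b i) ^+ 2 <= (\sum_i a i ^+ 2) * (\sum_i b i ^+ 2).
Proof.
have : 0 <= \sum_i \sum_j (a i * b j - a j * b i) ^+ 2.
  by apply: sumr_ge0 => i _; apply: sumr_ge0 => j _; exact: sqr_ge0.
have -> : \sum_i \sum_j (a i * b j - a j * b i) ^+ 2 =
    \sum_i \sum_j (a i ^+ 2 * b j ^+ 2) + \sum_i \sum_j (a j ^+ 2 * b i ^+ 2)
    - 2 * \sum_i \sum_j ((a i * b i) * (a j * b j)).
  rewrite mulr_sumr -big_split/= -sumrB; apply: eq_bigr => i _.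
  rewrite mulr_sumr -big_split/= -sumrB; apply: eq_bigr => j _; ring.
rewrite [X in _ + X - _]exchange_big/=.
have dist (u v : I -> R) :
    \sum_i \sum_j (u i * v j) = (\sum_i u i) * (\sum_i v i).
  by rewrite mulr_suml; apply: eq_bigr => i _; rewrite mulr_sumr.
by rewrite !dist -expr2; lra.
Qed.

Lemma sqn_mulmx (p q r : nat) (M : 'M[R]_(p, q)) (X : 'M[R]_(q, r)) :
  sqn (M *m X) <= sqn M * sqn X.
Proof.
rewrite /sqn mulr_suml; apply: ler_sum => i _.
rewrite [X in _ * X]exchange_big/= mulr_sumr; apply: ler_sum => j _.
by rewrite mxE; exact: cauchy_schwarz.
Qed.

(** The real 2 x 2 matrix of the multiplication by a + i b, acting on column
    vectors (real part, imaginary part). *)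
Definition cmulmx (a b : R) : 'M[R]_2 :=
  \matrix_(i, j) (if i == j then a else if i == ord0 then - b else b).

Lemma dot_cmulmx p (a b : R) (Z : 'M[R]_(2, p)) :
  \sum_i \sum_j 2 * Z i j * (cmulmx a b *m Z) i j = 2 * a * sqn Z.
Proof.
rewrite /sqn mulr_sumr !big_ord_recl !big_ord0 !addr0 !mulr_sumr -!big_split/=.
apply: eq_bigr => j _; rewrite !mxE !big_ord_recl !big_ord0 !mxE/=.
by ring.
Qed.

(** |z|^2 has the derivative 2 a |z|^2 along z' = (a + i b) z. *)
Lemma sqn_expmx_cmul_ge p (a b t : R) (Z : 'M[R]_(2, p)) : 0 <= a -> 0 <= t ->
  sqn Z <= sqn (expmx (cmulmx a b) t *m Z).
Proof.
move=> a0 t0.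
have fl := @flow_expmx_shift R 2 p (cmulmx a b) Z 0 0 t.
have [c d] := sqn_flow fl.
have := nondecr_segment t0 c d; rewrite !addr0 expmx0 mul1mx; apply => s _.
by rewrite dot_cmulmx mulr_ge0 ?sqn_ge0// mulr_ge0.
Qed.

End Auxiliary.

(** * Impulse instants *)

Lemma archi_nat (R : realType) (x : R) : exists l : nat, x <= l%:R.
Proof.
exists (Num.bound `|x|); apply: le_trans (ler_norm _) (ltW _).
by apply: archi_boundP.
Qed.

Section Instants.
Variables (R : realType) (hbar : nat) (tau : nat -> R).
Hypothesis hbar_gt0 : (0 < hbar)%N.
Hypothesis Htau : impulse_instants hbar tau.

Lemma tau0 : tau 0%N = 0. Proof. by case: Htau. Qed.

Lemma tau_lt j k : (j < k)%N -> tau j < tau k.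
Proof.
case: Htau => _ tS _; elim: k => // k IH.
rewrite ltnS leq_eqVlt => /orP[/eqP->//|].
by move=> /IH /lt_trans; apply.
Qed.

Lemma tau_le j k : (j <= k)%N -> tau j <= tau k.
Proof. by rewrite leq_eqVlt => /orP[/eqP->//|/tau_lt/ltW]. Qed.

Lemma tau_ge0 j : 0 <= tau j. Proof. by rewrite -tau0 tau_le. Qed.

(** The instants are unbounded because they repeat with the period t_hbar. *)
Lemma tau_period (l : nat) : tau (l * hbar)%N = l%:R * tau hbar.
Proof.
case: Htau => t0 _ tP; elim: l => [|l IH]; first by rewrite mul0n t0 mul0r.
have [->|l0] := eqVneq l 0%N; first by rewrite mul1n mul1r.
have lh0 : (0 < l * hbar)%N by rewrite muln_gt0 lt0n l0.
have /eqP := tP _ lh0; rewrite subr_eq IH mulSn addnC => /eqP ->.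
by rewrite -addn1 natrD mulrDl mul1r addrC.
Qed.

Lemma tau_period_gt0 : 0 < tau hbar.
Proof. by rewrite -tau0 tau_lt. Qed.

Lemma tau_unbounded (t : R) : exists j, t <= tau j.
Proof.
have [l tl] := archi_nat (t / tau hbar).
exists (l * hbar)%N; rewrite tau_period -ler_pdivrMr//; exact: tau_period_gt0.
Qed.

Lemma tau_cover (t : R) : 0 < t -> exists j, tau j < t <= tau j.+1.
Proof.
move=> t0; have ex := tau_unbounded t.
case: (@ex_minnP (fun j => t <= tau j) ex) => k tk kmin.
case: k tk kmin => [|k] tk kmin; first by move: tk; rewrite tau0 leNgt t0.
by exists k; rewrite tk andbT ltNge; apply/negP => /kmin; rewrite ltnn.
Qed.

Lemma tau_cover_uniq (t : R) j k :
  tau j < t <= tau j.+1 -> tau k < t <= tau k.+1 -> j = k.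
Proof.
move=> /andP[jt tj] /andP[kt tk]; apply/eqP; rewrite eqn_leq.
apply/andP; split; rewrite leqNgt; apply/negP => /tau_le.
  by rewrite leNgt (lt_le_trans jt tk).
by rewrite leNgt (lt_le_trans kt tj).
Qed.

(** The number of impulses strictly before the time t, with the default value 0
    for t <= 0. *)
Definition impulse_count (t : R) : nat :=
  xget 0%N [set j | tau j < t <= tau j.+1].

Lemma impulse_countE t j : tau j < t <= tau j.+1 -> impulse_count t = j.
Proof.
move=> jt; rewrite /impulse_count; case: xgetP => [k _ kt|/(_ j)//].
exact: tau_cover_uniq kt jt.
Qed.

Lemma impulse_count_le1 t : t <= tau 1%N -> impulse_count t = 0%N.
Proof.
move=> t1; have [t0|t0] := leP t 0; last first.
  by apply: impulse_countE; rewrite tau0 t0.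
rewrite /impulse_count; case: xgetP => [k _ /andP[kt _]|//].
by move: (le_lt_trans (tau_ge0 k) kt); rewrite ltNge t0.
Qed.

Lemma impulse_count_near t : 0 <= t -> (forall j, (0 < j)%N -> t != tau j) ->
  \forall s \near t, impulse_count s = impulse_count t.
Proof.
move=> t0 tn; have [t1|t1] := ltP t (tau 1%N).
  rewrite (impulse_count_le1 (ltW t1)).
  near=> s; apply: impulse_count_le1; apply: ltW.
  by near: s; exact: lt_nbhsl.
have tp : 0 < t by rewrite (lt_le_trans _ t1)// -tau0 tau_lt.
have [j jt] := tau_cover tp; rewrite (impulse_countE jt).
have /andP[jt1 jt2] := jt.
have jt3 : t < tau j.+1 by rewrite lt_neqAle tn.
near=> s; apply: impulse_countE; apply/andP; split.
  by near: s; exact: lt_nbhsr.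
by apply: ltW; near: s; exact: lt_nbhsl.
Unshelve. all: by end_near. Qed.

End Instants.

(** * Closed-loop trajectories and hidden modes *)

Section ClosedLoopTrajectory.
Variables (R : realType) (n m hbar : nat).
Variables (A : 'M[R]_n) (B : 'I_hbar -> 'M[R]_(n, m)).
Variables (F : 'I_hbar -> 'M[R]_(m, n)) (tau : nat -> R).
Hypothesis hbar_gt0 : (0 < hbar)%N.
Hypothesis Htau : impulse_instants hbar tau.

(** The phase of the j-th impulse counted from 0, as an ordinal. *)
Definition phase (j : nat) : 'I_hbar := Ordinal (ltn_pmod j hbar_gt0).

Lemma theta_phase j (k : 'I_hbar) : theta hbar j.+1 = k.+1 -> phase j = k.
Proof. by rewrite thetaE// => -[jk]; apply/val_inj. Qed.

(** Value at time 0 of the free motion that coincides with the closed-loop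
    trajectory between the impulses j and j + 1. *)
Fixpoint loop_coef (x0 : 'cV[R]_n) (j : nat) : 'cV[R]_n :=
  if j is i.+1 then
    expmx A (- tau i.+1) *m ((1%:M + B (phase i) *m F (phase i)) *m
      (expmx A (tau i.+1) *m loop_coef x0 i))
  else x0.

(** The closed-loop trajectory with the initial state x0. *)
Definition loop_traj (x0 : 'cV[R]_n) (t : R) : 'cV[R]_n :=
  expmx A t *m loop_coef x0 (impulse_count tau t).

Lemma loop_traj_at x0 t j : tau j < t <= tau j.+1 ->
  loop_traj x0 t = expmx A t *m loop_coef x0 j.
Proof. by move=> jt; rewrite /loop_traj (impulse_countE Htau jt). Qed.

(** The jump relation at the instant t_(j+1). *)
Lemma loop_coefS x0 j : expmx A (tau j.+1) *m loop_coef x0 j.+1 =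
  (1%:M + B (phase j) *m F (phase j)) *m (expmx A (tau j.+1) *m loop_coef x0 j).
Proof. by rewrite /= mulmxA expmxKN mul1mx. Qed.

Lemma loop_traj0 x0 : loop_traj x0 0 = x0.
Proof.
by rewrite /loop_traj (impulse_count_le1 Htau) ?expmx0 ?mul1mx// (tau_ge0 Htau).
Qed.

Lemma loop_traj_solution x0 :
  closed_loop_solution A B tau F (loop_traj x0).
Proof.
split.
- move=> t t0 tn.
  have near := impulse_count_near hbar_gt0 Htau t0 (fun j _ => tn j).
  pose f s := expmx A s *m loop_coef x0 (impulse_count tau t).
  apply: (@near_eq_is_derive R _ _ f); last exact: is_derive_expmx_mul.
  by apply: filterS near => s st; rewrite /f /loop_traj st.
- move=> t t0; have [j jt] := tau_cover hbar_gt0 Htau t0.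
  rewrite (loop_traj_at _ jt).
  apply: (@cvg_trans _ ((fun s => expmx A s *m loop_coef x0 j) @ t^'-)).
    have /andP[jt1 jt2] := jt.
    apply: near_eq_cvg; near=> s; rewrite (@loop_traj_at x0 s j)//.
    apply/andP; split.
      by near: s; exact: nbhs_left_gt.
    by apply: le_trans jt2; near: s; exact: nbhs_left_le.
  by apply: cvg_at_left_filter; exact: continuous_expmx_mul.
- move=> t t0 tn; have near := impulse_count_near hbar_gt0 Htau t0 tn.
  apply: cvg_within_filter.
  apply: (@cvg_trans _ ((fun s => expmx A s *m
      loop_coef x0 (impulse_count tau t)) @ t));
    last exact: continuous_expmx_mul.
  apply: near_eq_cvg; apply: filterS near => s st.
  by rewrite /loop_traj st.
- case=> // j k _ /theta_phase <-.
  have jj : tau j < tau j.+1 <= tau j.+1 by rewrite (tau_lt Htau)/=.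
  set xj := loop_traj x0 (tau j.+1).
  have xjE : xj = expmx A (tau j.+1) *m loop_coef x0 j.
    by rewrite /xj (loop_traj_at _ jj).
  have -> : B (phase j) *m (F (phase j) *m xj) =
      expmx A (tau j.+1) *m loop_coef x0 j.+1 - xj.
    by rewrite loop_coefS -xjE mulmxDl mul1mx addrC addKr mulmxA.
  apply: cvgB; last exact: cvg_cst.
  apply: (@cvg_trans _
    ((fun s => expmx A s *m loop_coef x0 j.+1) @ (tau j.+1)^'+)).
    apply: near_eq_cvg; near=> s; rewrite (@loop_traj_at x0 s j.+1)//.
    apply/andP; split; first by near: s; exact: nbhs_right_gt.
    by near: s; apply: nbhs_right_ltW; exact: (tau_lt Htau).
  by apply: cvg_at_right_filter; exact: continuous_expmx_mul.
Unshelve. all: by end_near. Qed.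

(** A mode that no input matrix excites and whose rate a is nonnegative does
    not decay along closed-loop trajectories. *)
Lemma loop_traj_mode (a b : R) (V : 'M[R]_(2, n)) x0 j : 0 <= a ->
  V *m A = cmulmx a b *m V -> (forall k, V *m B k = 0) ->
  sqn (V *m x0) <= sqn (V *m loop_traj x0 (tau j.+1)).
Proof.
move=> a0 VA VB.
have VP i : V *m loop_traj x0 (tau i.+1) =
    V *m (expmx A (tau i.+1) *m loop_coef x0 i.+1).
  rewrite loop_coefS mulmxDl mul1mx mulmxDr -!mulmxA [V *m (B _ *m _)]mulmxA VB.
  rewrite mul0mx addr0.
  by rewrite (@loop_traj_at _ _ i)// lexx andbT (tau_lt Htau).
rewrite VP; elim: j => [|j IH].
  rewrite -VP (@loop_traj_at _ _ 0%N) ?lexx ?andbT ?(tau_lt Htau)//=.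
  rewrite mulmxA (expmx_intertwine _ VA) -mulmxA.
  by apply: sqn_expmx_cmul_ge; rewrite ?(tau_ge0 Htau).
apply: le_trans IH _; rewrite -[in leRHS]VP (@loop_traj_at _ _ j.+1);
  last by rewrite lexx andbT (tau_lt Htau).
have -> (c : 'cV[R]_n) : V *m (expmx A (tau j.+2) *m c) =
    expmx (cmulmx a b) (tau j.+2 - tau j.+1) *m
      (V *m (expmx A (tau j.+1) *m c)).
  rewrite -{1}[tau j.+2](subrK (tau j.+1)) [in LHS]expmxD !mulmxA.
  by rewrite (expmx_intertwine _ VA).

by apply: sqn_expmx_cmul_ge => //; rewrite subr_ge0 ltW ?(tau_lt Htau).
Qed.

(** A stable closed loop has no such mode other than 0: stability forces
    V x0 = 0 for every initial state x0. *)
Lemma stable_mode_eq0 (a b : R) (V : 'M[R]_(2, n)) : 0 <= a ->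
  V *m A = cmulmx a b *m V -> (forall k, V *m B k = 0) ->
  closed_loop_stable A B tau F -> V = 0.
Proof.
move=> a0 VA VB [M [mu [M0 mu0 stab]]].
suff Vx (x0 : 'cV[R]_n) : V *m x0 = 0.
  apply/matrixP => i j; rewrite mxE.
  have := congr1 (fun X : 'cV_2 => X i ord0) (Vx (delta_mx j ord0)).
  by rewrite -colE !mxE.
apply: sqn_eq0; rewrite leNgt; apply/negP => V0.
set K := sqn V * (M ^+ 2 * sqn x0).
have K0 : 0 <= K.
  by rewrite mulr_ge0 ?sqn_ge0// mulr_ge0 ?sqr_ge0 ?sqn_ge0.
have bound j : sqn (V *m x0) * (1 + mu * tau j.+1) <= K.
  set t := tau j.+1; have t0 : 0 <= t by rewrite (tau_ge0 Htau).
  have e0 := expR_gt0 (mu * t).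
  have e1 : 1 + mu * t <= expR (mu * t) by exact: expR_ge1Dx.
  have e2 : 1 <= expR (mu * t).
    by rewrite (le_trans _ e1)// lerDl mulr_ge0// ltW.
  have xt : sqn (loop_traj x0 t) <= (M * expR (- mu * t)) ^+ 2 * sqn x0.
    rewrite -!euclidean_normE -exprMn lerXn2r ?nnegrE ?sqrtr_ge0//.
      by rewrite !mulr_ge0 ?expR_ge0 ?sqrtr_ge0// ltW.
    have := stab _ (loop_traj_solution x0) _ t0; by rewrite loop_traj0.
  have h : sqn (V *m x0) <= K * expR (- mu * t) ^+ 2.
    apply: le_trans (loop_traj_mode x0 j a0 VA VB) _.
    apply: le_trans (sqn_mulmx _ _) _; rewrite /K -mulrA.
    rewrite ler_wpM2l ?sqn_ge0// (le_trans xt)//.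
    by rewrite exprMn mulrAC.
  apply: (@le_trans _ _ (K * expR (- mu * t) ^+ 2 * expR (mu * t))).
    apply: ler_pM => //; first exact: sqn_ge0.
    by rewrite addr_ge0// mulr_ge0// ltW.
  rewrite -mulrA ler_piMr// mulNr expRN expr2 -mulrA mulVf ?gt_eqF// mulr1.
  by rewrite invf_le1.
have [l lK] := archi_nat (K / sqn (V *m x0) / (mu * tau hbar)).
have T0 := tau_period_gt0 hbar_gt0 Htau.
have [k kl] : exists k, tau (l * hbar)%N <= tau k.+1.
  by exists (l * hbar)%N; rewrite (tau_le Htau).
have := bound k; rewrite leNgt => /negP; apply.
rewrite mulrC -ltr_pdivrMr// ltr_pwDl//.
rewrite ler_pdivrMr ?mulr_gt0// in lK; apply: (le_trans lK).
by rewrite mulrCA ler_pM2l// -(tau_period hbar_gt0 Htau).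
Qed.

End ClosedLoopTrajectory.

(** * The Hautus condition and complex eigenvectors *)

Section ComplexModes.
Variables (R : realType) (n m hbar : nat).
Variables (A : 'M[R]_n) (B : 'I_hbar -> 'M[R]_(n, m)).

(** A left eigenvector of A for the eigenvalue [lambda] that all the input
    matrices annihilate. *)
Definition hidden_mode (lambda : R[i]) (v : 'rV[R[i]]_n) : Prop :=
  [/\ v != 0, v *m complexify A = lambda *: v &
      forall k, v *m complexify (B k) = 0].

(** The left kernel of the Hautus matrix consists of the hidden modes and 0. *)
Lemma mul_hautus (lambda : R[i]) (v : 'rV[R[i]]_n) :
  v *m hautus_matrix A B lambda = 0 <->
  v *m complexify A = lambda *: v /\ forall k, v *m complexify (B k) = 0.
Proof.
rewrite /hautus_matrix mul_mx_row mul_mxrow; split.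
  move/eqP; rewrite row_mx_eq0 => /andP[/eqP vA /eqP vB]; split.
    move/eqP: vA; rewrite mulmxBr subr_eq0 mul_mx_scalar => /eqP ->//.
  move=> k; have := congr1 (fun M => submxrow M k) vB.
  by rewrite /= mxrowK submxrow0.
move=> [vA vB]; rewrite mulmxBr mul_mx_scalar vA subrr.
rewrite (_ : mxrow _ = 0) ?row_mx0//.
by apply/mxrowP => k; rewrite mxrowK submxrow0; exact: vB.
Qed.

Lemma hautus_rankP (lambda : R[i]) :
  \rank (hautus_matrix A B lambda) <> n <-> exists v, hidden_mode lambda v.
Proof.
split=> [rk|[v [v0 vA vB]] rk].
  have : kermx (hautus_matrix A B lambda) != 0.
    by rewrite kermx_eq0; apply/negP => /eqP.
  move=> /rowV0Pn[v /sub_kermxP /mul_hautus[vA vB] v0]; exists v; split=> //.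
have vH : v *m hautus_matrix A B lambda = 0 by exact/mul_hautus.
have fr : row_free (hautus_matrix A B lambda) by exact/eqP.
move/eqP: v0; apply; apply: (row_free_inj fr); by rewrite vH mul0mx.
Qed.

(** The real and imaginary parts of a complex row vector, stacked. *)
Definition realify (q : nat) (v : 'rV[R[i]]_q) : 'M[R]_(2, q) :=
  \matrix_(i, j)
    if i == ord0 then complex.Re (v ord0 j) else complex.Im (v ord0 j).

Lemma realify_eq0 q (v : 'rV[R[i]]_q) : realify v = 0 -> v = 0.
Proof.
move=> v0; apply/rowP => j; rewrite mxE.
have := congr1 (fun M : 'M[R]_(2, q) => M ord0 j) v0.
have := congr1 (fun M : 'M[R]_(2, q) => M (lift ord0 ord0) j) v0.
by rewrite /= !mxE/=; case: (v ord0 j) => x y /= -> ->.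
Qed.

Lemma Re_sum (I : Type) (r : seq I) (f : I -> R[i]) :
  complex.Re (\sum_(i <- r) f i) = \sum_(i <- r) complex.Re (f i).
Proof. by apply: (big_morph (@complex.Re R)) => // -[x y] [z t]. Qed.

Lemma Im_sum (I : Type) (r : seq I) (f : I -> R[i]) :
  complex.Im (\sum_(i <- r) f i) = \sum_(i <- r) complex.Im (f i).
Proof. by apply: (big_morph (@complex.Im R)) => // -[x y] [z t]. Qed.

Lemma realify_mul p q (v : 'rV[R[i]]_p) (M : 'M[R]_(p, q)) :
  realify (v *m complexify M) = realify v *m M.
Proof.
apply/matrixP => i j; rewrite !mxE.
case: ifP => i0.
  rewrite Re_sum; apply: eq_bigr => k _; rewrite !mxE i0.
  by case: (v ord0 k) => x y /=; rewrite mulr0 subr0.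
rewrite Im_sum; apply: eq_bigr => k _; rewrite !mxE i0.
by case: (v ord0 k) => x y /=; rewrite mulr0 add0r.
Qed.

Lemma realify_scale q (lambda : R[i]) (v : 'rV[R[i]]_q) :
  realify (lambda *: v) =
  cmulmx (complex.Re lambda) (complex.Im lambda) *m realify v.
Proof.
apply/matrixP => i j; rewrite !mxE !big_ord_recl big_ord0 !mxE/= addr0.
case: lambda => a b; case: (v ord0 j) => x y /=.
case: (i =P ord0) => [->|i0] /=; first by rewrite mulNr.
have -> : (i == lift ord0 ord0) = true.
  by case: i i0 => [[|[|]]]//= hi h; exfalso; apply: h; apply/val_inj.
by rewrite addrC.
Qed.

End ComplexModes.

Section Necessity.
Variables (R : realType) (n m hbar : nat).
Variables (A : 'M[R]_n) (B : 'I_hbar -> 'M[R]_(n, m)).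

Lemma stabilizable_hautus (lambda : R[i]) : (0 < hbar)%N ->
  pair_stabilizable A B -> 0 <= complex.Re lambda ->
  \rank (hautus_matrix A B lambda) = n.
Proof.
move=> h0 [tau [Htau [F stab]]] l0.
apply: contrapT => /hautus_rankP[v [v0 vA vB]].
move/eqP: v0; apply; apply: realify_eq0.
apply: (stable_mode_eq0 h0 Htau (a := complex.Re lambda)
  (b := complex.Im lambda) l0 _ _ stab).
  by rewrite -realify_scale -vA realify_mul.
move=> k; rewrite -realify_mul vB; apply/matrixP => i j.
by rewrite !mxE; case: ifP.
Qed.

End Necessity.

(** * States whose free motion decays *)

Section DecayingStates.
Variables (R : realType) (n : nat) (A : 'M[R]_n).

(** The free motion t |-> exp (t A) X decays exponentially. *)
Definition decaying p (X : 'M[R]_(n, p)) : Prop :=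
  exists K e : R, 0 < e /\
    forall t, 0 <= t -> sqn (expmx A t *m X) <= K * expR (- e * t).

Lemma decaying_expmx p (X : 'M[R]_(n, p)) s :
  decaying X -> decaying (expmx A s *m X).
Proof.
move=> [K [e [e0 XK]]]; exists (sqn (expmx A s) * K), e; split=> // t t0.
rewrite mulmxA -expmxD addrC expmxD -mulmxA -mulrA.
by apply: le_trans (sqn_mulmx _ _) _; rewrite ler_wpM2l ?sqn_ge0// XK.
Qed.

Lemma decaying_col p (X : 'M[R]_(n, p)) j : decaying X -> decaying (col j X).
Proof.
move=> [K [e [e0 XK]]]; exists K, e; split=> // t t0.
apply: le_trans (XK t t0).
rewrite colE mulmxA -colE /sqn; apply: ler_sum => i _; rewrite big_ord1 mxE.
rewrite (bigD1 j)//= lerDl; apply: sumr_ge0 => *; exact: sqr_ge0.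
Qed.

Lemma decaying0 p : decaying (0 : 'M[R]_(n, p)).
Proof.
exists 0, 1; split=> // t t0; by rewrite mulmx0 sqn0 mul0r.
Qed.

Lemma dot_mulmx_cmul (a b : R) (X : 'M[R]_(n, 2)) :
  \sum_i \sum_j 2 * X i j * (X *m (cmulmx a b)^T) i j = 2 * a * sqn X.
Proof.
rewrite /sqn mulr_sumr; apply: eq_bigr => i _.
rewrite !big_ord_recl !big_ord0 !mxE !big_ord_recl !big_ord0 !mxE/=; ring.
Qed.

Lemma flow_expmx_mul p (X : 'M[R]_(n, p)) a b :
  lin_flow A (fun t => expmx A t *m X) a b.
Proof.
rewrite (_ : (fun t => _) = (fun t => expmx A (t + 0) *m X)).
  exact: flow_expmx_shift.
by apply/funext => t; rewrite addr0.
Qed.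

(** The columns of X are the real and imaginary parts of a complex vector x;
    the hypothesis says that (A - z) x decays, where z = a + i b.  Writing G for
    (A - z) x, the function rho = |exp (t A) x|^2 satisfies
    rho' <= a rho + |exp (t A) G|^2 / |a|. *)
Lemma decaying_resolvent (a b : R) (X : 'M[R]_(n, 2)) : a < 0 ->
  decaying (A *m X - X *m (cmulmx a b)^T) -> decaying X.
Proof.
move=> a0 [K [e2 [e20 XK]]].
set G := A *m X - _ in XK.
pose e := e2 / 2; have e0 : 0 < e by rewrite divr_gt0.
have K0 : 0 <= K.
  have := XK 0 (lexx _); rewrite mulr0 expR0 mulr1; exact/le_trans/sqn_ge0.
pose K' := K / - a.
have K'0 : 0 <= K' by rewrite divr_ge0// oppr_ge0 ltW.
(* exp (c t) rho + (K' / e) exp (- e t) is nonincreasing for this rate c. *)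
pose c := Num.min (- a) e.
have c0 : 0 < c by rewrite lt_min oppr_gt0 a0 e0.
have ca : c <= - a by rewrite ge_min lexx.
have ce : c <= e by rewrite ge_min lexx orbT.
exists (sqn X + K' / e), c; split=> // t t0.
pose Z s := expmx A s *m X.
have [rc rd] := sqn_flow (flow_expmx_mul X 0 t).
pose h s := expR (c * s) * sqn (Z s) + K' / e * expR (- e * s).
suff : h t <= h 0.
  rewrite /h !mulr0 !expR0 mul1r mulr1 /Z expmx0 mul1mx => hh.
  rewrite mulNr expRN ler_pdivlMr ?expR_gt0// mulrC.
  apply: le_trans hh; rewrite lerDl mulr_ge0 ?expR_ge0// divr_ge0// ltW//.
pose drho s := \sum_i \sum_j 2 * Z s i j * (A *m Z s) i j.
apply: (@nonincr_segment R h (fun s => expR (c * s) * (c * sqn (Z s) + drho s)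
  - K' * expR (- e * s)) 0 t t0).
- apply: within_continuousD; apply: within_continuousM => //.
  + exact/continuous_subspaceT/continuous_expRZ.
  + by move=> s; exact: cvg_cst.
  + exact/continuous_subspaceT/continuous_expRZ.
- move=> s st; have d1 := is_deriveM (is_derive_expRZ c s) (rd s st).
  have d2 := is_deriveZ (K' / e) (is_derive_expRZ (- e) s).
  have := is_deriveD d1 d2 => /is_derive_eq; apply.
  have KE : K' / e * e = K' by rewrite divfK ?gt_eqF.
  rewrite /GRing.scale/= -/(drho s) -[X in _ = _ - X * _]KE -/(Z s).
  by move: (drho s) (sqn _) (expR _) (expR _) (K' / e) => *; ring.
- move=> s; rewrite in_itv/= => /andP[s0 _].
  have Gs := XK s (ltW s0).
  have AZ : A *m Z s = Z s *m (cmulmx a b)^T + expmx A s *m G.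
    by rewrite /Z /G mulmxBr !mulmxA expmxC addrC subrK.
  have dr : drho s <= a * sqn (Z s) + sqn (expmx A s *m G) / - a.
    have -> : a * sqn (Z s) = 2 * a * sqn (Z s) + - a * sqn (Z s) by ring.
    rewrite -(dot_mulmx_cmul a b) [_ / - a]mulrC /drho AZ.
    rewrite [sqn (expmx A s *m G)]/sqn.
    rewrite [X in - a * X]/sqn !mulr_sumr -!big_split/=.
    apply: ler_sum => i _; rewrite !mulr_sumr -!big_split/=.
    apply: ler_sum => j _.
    have addE (P Q : 'M[R]_(n, 2)) : (P + Q) i j = P i j + Q i j by rewrite mxE.
    rewrite addE mulrDr -addrA lerD2l.
    set z := Z s i j; set g := (expmx A s *m G) i j.
    have a1 : 0 < - a by rewrite oppr_gt0.
    rewrite -(ler_pM2l a1) [leRHS]mulrDr mulVKf ?gt_eqF//.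
    have := sqr_ge0 (- a * z - g); rewrite sqrrB !exprMn; lra.
  have ec : expR (c * s) * expR (- e2 * s) <= expR (- e * s).
    rewrite -expRD ler_expR -mulrDl ler_wpM2r ?(ltW s0)//.
    have ee : e2 = e + e by rewrite /e -splitr.
    by rewrite ee opprD addrA gerDr subr_le0.
  rewrite subr_le0.
  apply: (@le_trans _ _ (expR (c * s) * (K' * expR (- e2 * s)))).
    rewrite ler_wpM2l ?expR_ge0//.
    apply: (@le_trans _ _ (c * sqn (Z s) +
        (a * sqn (Z s) + sqn (expmx A s *m G) / - a))).
      by rewrite lerD2l.
    have := mulr_ge0 (_ : 0 <= - a - c) (sqn_ge0 (Z s)).
    rewrite /K' mulrAC; have := ler_wpM2r _ Gs (x := (- a)^-1).
    rewrite invr_ge0 oppr_ge0 ltW// => /(_ isT) h1 h2.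
    have := h2; rewrite subr_ge0 => /(_ ca); lra.
  by rewrite mulrCA ler_wpM2l.
Qed.

End DecayingStates.

Section ComplexColumns.
Variables (R : realType) (n : nat).

(** The real and imaginary parts of a complex column vector, side by side. *)
Definition crealify (c : 'cV[R[i]]_n) : 'M[R]_(n, 2) := (realify c^T)^T.

Lemma crealify_mul (A : 'M[R]_n) (c : 'cV[R[i]]_n) :
  crealify (complexify A *m c) = A *m crealify c.
Proof.
rewrite /crealify trmx_mul (_ : (complexify A)^T = complexify A^T);
  last exact: map_trmx.
by rewrite realify_mul trmx_mul trmxK.
Qed.

Lemma crealify_scale z (c : 'cV[R[i]]_n) : crealify (z *: c) =
  crealify c *m (cmulmx (complex.Re z) (complex.Im z))^T.
Proof. by rewrite /crealify linearZ realify_scale trmx_mul. Qed.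

Lemma crealifyB (c d : 'cV[R[i]]_n) :
  crealify (c - d) = crealify c - crealify d.
Proof.
apply/matrixP => i j; rewrite !mxE.
by case: (c i ord0) => x y; case: (d i ord0) => z t; case: ifP.
Qed.

Lemma realify_crealify_eq0 (v : 'rV[R[i]]_n) (c : 'cV[R[i]]_n) :
  realify v *m crealify c = 0 -> v *m c = 0.
Proof.
move=> vc.
have vcE (i j : 'I_2) : \sum_k (if i == ord0 then complex.Re (v ord0 k)
    else complex.Im (v ord0 k)) * (if j == ord0 then complex.Re (c k ord0)
    else complex.Im (c k ord0)) = 0.
  have := congr1 (fun M : 'M[R]_(2, 2) => M i j) vc.
  rewrite mxE [RHS]mxE => h; rewrite -[RHS]h.
  apply: eq_bigr => k _; rewrite !mxE.
  by case: (i == ord0); case: (j == ord0).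
have rr := vcE ord0 ord0; have ri := vcE ord0 (lift ord0 ord0).
have ir := vcE (lift ord0 ord0) ord0.
have ii := vcE (lift ord0 ord0) (lift ord0 ord0).
apply/matrixP => i j; rewrite !ord1 !mxE; apply/eqP; rewrite eq_complex.
rewrite Re_sum Im_sum; apply/andP; split; apply/eqP.
  transitivity (\sum_k complex.Re (v ord0 k) * complex.Re (c k ord0) -
      \sum_k complex.Im (v ord0 k) * complex.Im (c k ord0)).
    rewrite -sumrB; apply: eq_bigr => k _ /=.
    by case: (v ord0 k) => x y; case: (c k ord0).
  by move: rr ii => /= -> ->; rewrite subr0.
transitivity (\sum_k complex.Re (v ord0 k) * complex.Im (c k ord0) +
    \sum_k complex.Im (v ord0 k) * complex.Re (c k ord0)).
  rewrite -big_split/=; apply: eq_bigr => k _ /=.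
  by case: (v ord0 k) => x y; case: (c k ord0).
by move: ri ir => /= -> ->; rewrite addr0.
Qed.

End ComplexColumns.

Section StableModes.
Variables (R : realType) (n' : nat).
Let n := n'.+1.
Variable A : 'M[R]_n.
Let Ac : 'M[R[i]]_n := complexify A.

(** Membership in the open left half plane. *)
Definition stable_root (z : R[i]) : bool := complex.Re z < 0.

(** A vector annihilated by a product of factors A - z with Re z < 0 decays. *)
Lemma decaying_stable_roots (s : seq R[i]) (c : 'cV[R[i]]_n) :
  all stable_root s -> foldl (fun d z => Ac *m d - z *: d) c s = 0 ->
  decaying A (crealify c).
Proof.
elim: s c => [|z s IH] c /=.
  move=> _ ->; rewrite (_ : crealify 0 = 0); first exact: decaying0.
  by apply/matrixP => i j; rewrite !mxE; case: ifP.
move=> /andP[z0 sS] /(IH _ sS); rewrite crealifyB crealify_mul crealify_scale.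
exact: decaying_resolvent.
Qed.

Lemma foldl_roots (s : seq R[i]) (c : 'cV[R[i]]_n) :
  foldl (fun d z => Ac *m d - z *: d) c s =
  horner_mx Ac (\prod_(z <- s) ('X - z%:P)) *m c.
Proof.
elim: s c => [|z s IH] c /=; first by rewrite big_nil rmorph1 mul1mx.
rewrite IH big_cons mulrC rmorphM/= -mulmxA; congr (_ *m _).
by rewrite rmorphB/= horner_mx_X horner_mx_C mulmxBl mul_scalar_mx.
Qed.

Lemma eigen_horner_mx (v : 'rV[R[i]]_n) z p :
  v *m Ac = z *: v -> v *m horner_mx Ac p = p.[z] *: v.
Proof.
move=> vA; elim/poly_ind: p => [|p c IH].
  by rewrite rmorph0 mulmx0 horner0 scale0r.
rewrite rmorphD rmorphM/= horner_mx_X horner_mx_C mulmxDr mulmxA IH.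
rewrite -scalemxAl vA mul_mx_scalar scalerA -scalerDl.
by rewrite hornerD hornerMX hornerC.
Qed.

(** A left eigenvector that annihilates every decaying state belongs to an
    eigenvalue in the closed right half plane: it annihilates the image of the
    product of A - z over the unstable roots z of the characteristic
    polynomial, by the Cayley-Hamilton theorem. *)
Lemma eigen_kills_decaying (v : 'rV[R[i]]_n) z : v != 0 ->
  v *m Ac = z *: v ->
  (forall x : 'cV[R]_n, decaying A x -> realify v *m x = 0) ->
  0 <= complex.Re z.
Proof.
move=> v0 vA vD; rewrite leNgt; apply/negP => z0.
have [rs rsE] := closed_field_poly_normal (char_poly Ac).
rewrite (monicP (char_poly_monic _)) scale1r in rsE.
pose s := [seq y <- rs | stable_root y].
pose u := [seq y <- rs | ~~ stable_root y].
have psu : char_poly Ac =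
    (\prod_(y <- s) ('X - y%:P)) * (\prod_(y <- u) ('X - y%:P)).
  rewrite rsE -big_cat; apply: perm_big.
  by rewrite perm_sym perm_filterC.
have CH := Cayley_Hamilton Ac; rewrite psu rmorphM/= in CH.
set U := horner_mx Ac (\prod_(y <- u) ('X - y%:P)) in CH.
have vU : v *m U = 0.
  apply/rowP => j; rewrite [RHS]mxE.
  have dj : decaying A (crealify (col j U)).
    apply: (@decaying_stable_roots s); first by rewrite /s filter_all.
    rewrite foldl_roots colE mulmxA [X in X *m _]CH.
    by rewrite mul0mx.
  have : v *m col j U = 0.
    apply: realify_crealify_eq0; apply/matrixP => i k.
    have := vD _ (decaying_col k dj); rewrite colE mulmxA -colE => vk.
    by have := congr1 (fun M : 'cV[R]_2 => M i ord0) vk; rewrite !mxE.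
  rewrite colE mulmxA -colE.
  by move=> /(congr1 (fun M : 'M[R[i]]_(1, 1) => M ord0 ord0)); rewrite !mxE.
move: vU; rewrite (eigen_horner_mx _ vA) => /eqP.
rewrite scaler_eq0 (negPf v0) orbF.
rewrite horner_prod; apply/negP; rewrite prodf_seq_neq0.
apply/allP => y; rewrite mem_filter => /andP[/= yu _].
rewrite hornerXsubC subr_eq0.
by apply: contra yu => /eqP <-.
Qed.

End StableModes.

(** * Choice of the sampling step *)

(** A subset of F^n closed under linear combinations is the row space of a
    matrix: take one of maximal rank with all its rows in the subset. *)
Lemma subspace_mx (F : fieldType) (n : nat) (P : 'rV[F]_n -> Prop) :
  P 0 -> (forall u v, P u -> P v -> P (u + v)) ->
  (forall a v, P v -> P (a *: v)) ->
  exists N : 'M[F]_n, forall v, P v <-> (v <= N)%MS.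
Proof.
move=> P0 PD PZ.
pose ranks k :=
  exists2 N : 'M[F]_n, (forall v, (v <= N)%MS -> P v) & \rank N = k.
have ex : exists k, `[< ranks k >].
  exists 0%N; apply/asboolP; exists 0; last by rewrite mxrank0.
  by move=> v; rewrite submx0 => /eqP ->.
have ub k : `[< ranks k >] -> (k <= n)%N.
  by move=> /asboolP[N _ <-]; exact: rank_leq_row.
case: (ex_maxnP ex ub) => k /asboolP[N NP Nk] kmax.
exists N => v; split=> [Pv|]; last exact: NP.
apply: contraT => vN.
have : (\rank (N + v)%MS <= k)%N.
  apply: kmax; apply/asboolP; exists (N + v)%MS => //.
  move=> u /sub_addsmxP[[w1 w2] /= ->].
  apply: PD; first by apply: NP; exact: submxMl.
  by have /sub_rVP[a ->] := submxMl w2 v; exact: PZ.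
rewrite -Nk leqNgt => /negP; case.
apply: rank_ltmx; rewrite /ltmx addsmxSl/=.
by apply: contra vN; apply: submx_trans; exact: addsmxSr.
Qed.

Section Sampling.
Variables (R : realType) (n' m hbar : nat).
Let n := n'.+1.
Variables (A : 'M[R]_n) (B : 'I_hbar -> 'M[R]_(n, m)).
Hypothesis hbar_gt0 : (0 < hbar)%N.

(** The input matrix of the impulse that occurs a time j d after the first one,
    transported back to the first impulse along the free motion. *)
Definition pulled_input (d : R) (j : nat) : 'M[R]_(n, m) :=
  expmx A (- (j%:R * d)) *m B (phase hbar_gt0 j).

(** Linear forms that neither the sampled inputs nor the decaying states
    detect. *)
Definition undetected (d : R) (v : 'rV[R]_n) : Prop :=
  (forall j, v *m pulled_input d j = 0) /\
  (forall x : 'cV[R]_n, decaying A x -> v *m x = 0).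

Lemma undetected_subspace d :
  exists N : 'M[R]_n, forall v, undetected d v <-> (v <= N)%MS.
Proof.
apply: subspace_mx => [|u v [u1 u2] [v1 v2]|a v [v1 v2]].
- by split=> *; rewrite mul0mx.
- split=> [j|x xD]; first by rewrite mulmxDl u1 v1 addr0.
  by rewrite mulmxDl u2// v2// addr0.
- split=> [j|x xD]; first by rewrite -scalemxAl v1 scaler0.
  by rewrite -scalemxAl v2// scaler0.
Qed.

(** The grid of step d / (hbar + 1) contains the grid of step d, with the same
    phases since hbar + 1 = 1 modulo hbar. *)
Lemma undetected_refine d v :
  undetected (d / hbar.+1%:R) v -> undetected d v.
Proof.
move=> [v1 v2]; split=> // j; have := v1 (j * hbar.+1)%N.
rewrite /pulled_input natrM -mulrA [_ * (d / _)]mulrC divfK ?pnatr_eq0//.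
rewrite (_ : phase _ (j * hbar.+1) = phase hbar_gt0 j)//.
by apply/val_inj; rewrite /= mulnS addnC modnMDl.
Qed.

(** Shifting the grid by one period preserves its phases. *)
Lemma undetected_period d v :
  undetected d v -> undetected d (v *m expmx A (- (hbar%:R * d))).
Proof.
move=> [v1 v2]; split=> [j|x xD].
  have := v1 (hbar + j)%N; rewrite /pulled_input natrD mulrDl opprD expmxD.
  rewrite !mulmxA (_ : phase _ (hbar + j) = phase hbar_gt0 j)//.
  by apply/val_inj; rewrite /= modnDl.
by rewrite -mulmxA; apply: v2; exact: decaying_expmx.
Qed.

(** Under the Hautus condition some uniform grid leaves no nonzero form
    undetected.  Along the steps d_i = (hbar + 1)^(-i), the spaces of undetected
    forms decrease, hence are eventually constant.  The stationary space is
    invariant under exp (- hbar d_i A) for all large i, hence under A, by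
    differentiation at 0.  If it were not zero, it would contain, over the
    complex numbers, a left eigenvector of A that annihilates all the B_k and
    all the decaying states. *)
Lemma exists_sampling :
  (forall lambda : R[i], (spectrum A `&` closed_right_half_plane) lambda ->
     \rank (hautus_matrix A B lambda) = n) ->
  exists2 d : R, 0 < d & forall v, undetected d v -> v = 0.
Proof.
move=> hautus; apply: contrapT => nex.
have nz d : 0 < d -> exists2 v, undetected d v & v != 0.
  move=> d0; apply: contrapT => nv; apply: nex; exists d => // v vd.
  by apply: contrapT => /eqP v0; apply: nv; exists v.
(* The multiplier hbar + 1 keeps the phases of the grid points. *)
pose q : R := hbar.+1%:R.
have q0 : 0 < q by rewrite ltr0n.
pose ds i : R := q^-1 ^+ i.
have ds0 i : 0 < ds i by rewrite exprn_gt0// invr_gt0.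
have [N NE] := choice (fun i => undetected_subspace (ds i)).
have NS i : (N i.+1 <= N i)%MS.
  apply/row_subP => k; apply/(NE i); apply: undetected_refine.
  rewrite -/q (_ : _ / q = ds i.+1); last by rewrite /ds exprSr.
  by apply/NE; exact: row_sub.
have Nle i j : (i <= j)%N -> (N j <= N i)%MS.
  elim: j => [|j IH]; first by rewrite leqn0 => /eqP ->.
  by rewrite leq_eqVlt => /orP[/eqP->//|/IH]; apply: submx_trans.
have [i0 i0min] : exists i0, forall i, (\rank (N i0) <= \rank (N i))%N.
  have ex : exists r, `[< exists i, \rank (N i) = r >].
    by exists (\rank (N 0%N)); apply/asboolP; exists 0%N.
  case: (ex_minnP ex) => r /asboolP[i0 <-] rmin; exists i0 => i.
  by apply: rmin; apply/asboolP; exists i.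
have Nstat i : (N i0 <= N (i0 + i)%N)%MS.
  have [_ /esym] := mxrank_leqif_sup (Nle _ _ (leq_addr i i0)).
  by move=> ->; rewrite eqn_leq i0min mxrankS ?Nle ?leq_addr.
have NA : (N i0 *m A <= N i0)%MS.
  apply/row_subP => k; rewrite row_mul submxE; apply/eqP/rowP => l.
  set v := row k _; set C := cokermx _; rewrite [RHS]mxE.
  have vN i : undetected (ds (i0 + i)) v.
    by apply/NE; apply: submx_trans (Nstat i); exact: row_sub.
  have uC (u : 'rV_n) : (u <= N i0)%MS -> u *m col l C = 0.
    by rewrite submxE => /eqP uC; rewrite colE mulmxA uC mul0mx.
  have : v *m A *m col l C = 0.
    apply: (@expmx_generator R n A v _ (fun i => - (hbar%:R * ds (i0 + i)%N))).
    - rewrite -oppr0; apply: cvgN; rewrite -[X in _ --> X](mulr0 hbar%:R).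
      apply: cvgMr.
      rewrite (_ : (fun i => _) = (fun i => q^-1 ^+ (i + i0)%N)); last first.
        by apply/funext => i; rewrite /ds addnC.
      rewrite (cvg_shiftn i0 (fun i => q^-1 ^+ i)); apply: cvg_expr.
      rewrite ger0_norm ?invr_ge0// ?(ltW q0)// invf_lt1// ltr1n.
      by rewrite ltnS.
    - by move=> i; rewrite oppr_eq0 mulf_neq0 ?pnatr_eq0 -?lt0n// gt_eqF.
    - by apply: uC; exact: row_sub.
    - move=> i; apply: uC; apply: submx_trans (Nle _ _ (leq_addr i i0)).
      by apply/NE; apply: undetected_period; exact: vN.
  rewrite colE mulmxA -colE.
  by move=> /(congr1 (fun M : 'M[R]_(1, 1) => M ord0 ord0)); rewrite !mxE.
set r := \rank (N i0); pose Nb := row_base (N i0) : 'M[R]_(r, n).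
have rN : (Nb <= N i0)%MS by rewrite eq_row_base.
have NbA : (Nb *m A <= Nb)%MS.
  by rewrite /Nb eq_row_base (submx_trans _ NA)// submxMr.
pose Y := Nb *m A *m pinvmx Nb.
have YE : Nb *m A = Y *m Nb by rewrite /Y mulmxKpV.
have r0 : (0 < r)%N.
  rewrite lt0n mxrank_eq0; have [v vd v0] := nz _ (ds0 i0).
  apply: contra v0 => /eqP N0; move/NE: vd; rewrite N0.
  by rewrite submx0.
have Nbu k : undetected (ds i0) (row k Nb).
  by apply/NE; apply: submx_trans rN; exact: row_sub.
have NbB k : Nb *m B k = 0.
  have h : Nb *m pulled_input (ds i0) k = 0.
    apply/row_matrixP => l; rewrite row_mul row0; exact: (Nbu l).1.
  have pk : phase hbar_gt0 k = k by apply/val_inj; rewrite /= modn_small.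
  move: h; rewrite /pulled_input pk mulmxA (expmx_intertwine _ YE) -mulmxA.
  move=> /(congr1 (mulmx (expmx Y (k%:R * ds i0)))).
  by rewrite mulmxA expmxKN mul1mx mulmx0.
have NbD (x : 'cV[R]_n) : decaying A x -> Nb *m x = 0.
  move=> xD; apply/row_matrixP => l; rewrite row_mul row0; exact: (Nbu l).2.
have [lambda] := eigenvalue_closed (complexify Y) r0.
move=> /eigenvalueP[y yY y0].
pose v := y *m complexify Nb.
have v0 : v != 0.
  apply: contra y0 => /eqP v0; apply/eqP.
  have fr : row_free (complexify Nb) by rewrite row_free_map row_base_free.
  by apply: (row_free_inj fr); rewrite mul0mx.
have vA : v *m complexify A = lambda *: v.
  rewrite /v -mulmxA -map_mxM YE map_mxM mulmxA yY -scalemxAl.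
  by [].
have l0 : 0 <= complex.Re lambda.
  apply: (eigen_kills_decaying v0 vA) => x xD.
  by rewrite /v realify_mul -mulmxA NbD// mulmx0.
have : \rank (hautus_matrix A B lambda) = n.
  apply: hautus; split; last exact: l0.
  by apply/eigenvalueP; exists v.
apply/hautus_rankP; exists v; split=> // k.
by rewrite /v -mulmxA -map_mxM NbB map_mx0 mulmx0.
Qed.

End Sampling.

(** * Quadratic forms and the Riccati step *)

Section QuadraticForms.
Variable R : realType.

(** The bilinear form of the matrix P. *)
Definition bilin p q (P : 'M[R]_(p, q)) (x : 'cV[R]_p) (y : 'cV[R]_q) : R :=
  (x^T *m P *m y) ord0 ord0.

(** The quadratic form of the matrix P. *)
Definition qform n (P : 'M[R]_n) (x : 'cV[R]_n) : R := bilin P x x.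

Lemma bilinDl p q (P : 'M[R]_(p, q)) x1 x2 y :
  bilin P (x1 + x2) y = bilin P x1 y + bilin P x2 y.
Proof. by rewrite /bilin linearD/= !mulmxDl mxE. Qed.

Lemma bilinDr p q (P : 'M[R]_(p, q)) x y1 y2 :
  bilin P x (y1 + y2) = bilin P x y1 + bilin P x y2.
Proof. by rewrite /bilin mulmxDr mxE. Qed.

Lemma bilinZl p q (P : 'M[R]_(p, q)) s x y :
  bilin P (s *: x) y = s * bilin P x y.
Proof.
rewrite /bilin (_ : (s *: x)^T = s *: x^T); last exact: linearZ.
by rewrite -!scalemxAl mxE.
Qed.

Lemma bilinZr p q (P : 'M[R]_(p, q)) s x y :
  bilin P x (s *: y) = s * bilin P x y.
Proof. by rewrite /bilin -scalemxAr mxE. Qed.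

Lemma bilin_mull p q r (P : 'M[R]_(p, q)) (M : 'M[R]_(p, r)) x y :
  bilin P (M *m x) y = bilin (M^T *m P) x y.
Proof. by rewrite /bilin trmx_mul !mulmxA. Qed.

Lemma bilin_mulr p q r (P : 'M[R]_(p, q)) (M : 'M[R]_(q, r)) x y :
  bilin P x (M *m y) = bilin (P *m M) x y.
Proof. by rewrite /bilin !mulmxA. Qed.

Lemma bilinC p q (P : 'M[R]_(p, q)) x y : bilin P x y = bilin P^T y x.
Proof.
rewrite /bilin; transitivity ((x^T *m P *m y)^T ord0 ord0).
  by rewrite [RHS]mxE.
by rewrite !trmx_mul trmxK mulmxA.
Qed.

Lemma bilinDm p q (P Q : 'M[R]_(p, q)) x y :
  bilin (P + Q) x y = bilin P x y + bilin Q x y.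
Proof. by rewrite /bilin mulmxDr mulmxDl mxE. Qed.

Lemma qformB n (P Q : 'M[R]_n) x : qform (P - Q) x = qform P x - qform Q x.
Proof. by rewrite /qform /bilin mulmxBr mulmxBl !mxE. Qed.

Lemma qform1 n (x : 'cV[R]_n) : qform 1%:M x = sqn x.
Proof.
rewrite /qform /bilin mulmx1 mxE /sqn; apply: eq_bigr => i _.
by rewrite mxE big_ord1 expr2.
Qed.

Lemma qform0 n (x : 'cV[R]_n) : qform 0 x = 0.
Proof. by rewrite /qform /bilin mulmx0 mul0mx mxE. Qed.

Lemma qform_mul n p (P : 'M[R]_n) (M : 'M[R]_(n, p)) x :
  qform P (M *m x) = qform (M^T *m P *m M) x.
Proof. by rewrite /qform bilin_mull bilin_mulr. Qed.

Lemma qformD n (P : 'M[R]_n) x y : P^T = P ->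
  qform P (x + y) = qform P x + 2 * bilin P y x + qform P y.
Proof.
move=> Ps; rewrite /qform bilinDl !bilinDr [bilin P x y]bilinC Ps; ring.
Qed.

(** Symmetric positive semidefinite matrices. *)
Definition psd n (P : 'M[R]_n) : Prop := P^T = P /\ forall x, 0 <= qform P x.

Lemma qform_sum n (P : 'M[R]_n) x :
  qform P x = \sum_i \sum_j x i ord0 * P i j * x j ord0.
Proof.
rewrite /qform /bilin mxE exchange_big/=; apply: eq_bigr => j _.
by rewrite mxE mulr_suml; apply: eq_bigr => i _; rewrite mxE.
Qed.

Lemma bilin_delta n (P : 'M[R]_n) i j :
  bilin P (delta_mx i ord0) (delta_mx j ord0) = P i j.
Proof.
rewrite /bilin trmx_delta -rowE -colE !mxE.
by [].
Qed.

Lemma psd_le_trace n (P : 'M[R]_n) x : psd P ->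
  qform P x <= n%:R * \tr P * sqn x.
Proof.
move=> [Ps Pp]; rewrite qform_sum.
have Pii i : 0 <= P i i.
  by have := Pp (delta_mx i ord0); rewrite /qform bilin_delta.
have cross i j : x i ord0 * P i j * x j ord0 <=
    (x i ord0 ^+ 2 * P i i + x j ord0 ^+ 2 * P j j) / 2.
  set a := x i ord0; set b := x j ord0.
  have := Pp (delta_mx i ord0 *m a%:M + delta_mx j ord0 *m (- b)%:M).
  rewrite !mul_mx_scalar.
  have bZ (s t : R) k l :
      bilin P (s *: delta_mx k ord0) (t *: delta_mx l ord0) = s * t * P k l.
    by rewrite bilinZl bilinZr bilin_delta mulrA.
  rewrite (qformD _ _ Ps) /qform !bZ.
  have -> : P j i = P i j by rewrite -{1}Ps mxE.
  lra.
have -> : n%:R * \tr P * sqn x =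
    \sum_i \sum_j (P i i * sqn x + P j j * sqn x) / 2.
  under eq_bigr do under eq_bigr do rewrite -mulrDl -mulrA.
  under eq_bigr do rewrite -mulr_suml big_split/= sumr_const card_ord.
  rewrite -mulr_suml big_split/= sumr_const card_ord sumrMnl -/(\tr P).
  by rewrite -[\tr P *+ n]mulr_natl; move: (n%:R) (\tr P) (sqn x) => *; field.
apply: ler_sum => i _; apply: ler_sum => j _; apply: le_trans (cross i j) _.
rewrite ler_pM2r ?invr_gt0//.
by apply: lerD; rewrite mulrC ler_wpM2l// sqr_le_sqn.
Qed.

End QuadraticForms.

Section RiccatiStep.
Variables (R : realType) (n m : nat) (E : 'M[R]_n) (B : 'M[R]_(n, m)).

(** For P positive semidefinite, the minimum over u of
    |x|^2 + |u|^2 + P(E (x + B u)), where P stands for its quadratic form, is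
    attained at u = [riccati_gain P] x and equals the quadratic form of
    [riccati P] at x. *)
Definition riccati_gain (P : 'M[R]_n) : 'M[R]_(m, n) :=
  - (invmx (1%:M + B^T *m (E^T *m P *m E) *m B) *m (B^T *m (E^T *m P *m E))).

Definition riccati (P : 'M[R]_n) : 'M[R]_n :=
  let F := riccati_gain P in let C := E *m (1%:M + B *m F) in
  1%:M + F^T *m F + C^T *m P *m C.

Lemma riccatiE P x : qform (riccati P) x =
  sqn x + sqn (riccati_gain P *m x) +
  qform P (E *m (x + B *m (riccati_gain P *m x))).
Proof.
rewrite -!qform1 qform_mul mulmx1.
have -> : x + B *m (riccati_gain P *m x) = (1%:M + B *m riccati_gain P) *m x.
  by rewrite mulmxDl mul1mx mulmxA.
rewrite mulmxA qform_mul /riccati /qform !bilinDm.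
by [].
Qed.

(** The normal equation of the minimization.  Its matrix S is invertible as
    w^T S w >= |w|^2. *)
Lemma riccati_normal P : psd P ->
  (1%:M + B^T *m (E^T *m P *m E) *m B) *m riccati_gain P =
  - (B^T *m (E^T *m P *m E)).
Proof.
move=> [Ps Pp]; rewrite /riccati_gain mulmxN.
set S := 1%:M + _; rewrite [S *m _]mulmxA mulmxV ?mul1mx//.
rewrite -unitmx_tr -row_free_unit -kermx_eq0.
apply/rowV0P => v /sub_kermxP vS.
have : qform S v^T = 0.
  rewrite /qform /bilin trmxK.
  have Ss : S^T = S.
    by rewrite /S linearD/= trmx1 !trmx_mul !trmxK Ps !mulmxA.
  by rewrite -Ss vS mul0mx mxE.
rewrite /S /qform bilinDm -/(qform _ _) qform1.
have := Pp (E *m (B *m v^T)); rewrite mulmxA qform_mul trmx_mul !mulmxA /qform.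
move=> h /eqP; rewrite addr_eq0 => /eqP v0.
have : sqn v^T <= 0 by rewrite v0 oppr_le0.
by move=> /sqn_eq0 /(congr1 trmx); rewrite trmxK trmx0.
Qed.

Lemma riccati_le P x u : psd P ->
  qform (riccati P) x <= sqn x + sqn u + qform P (E *m (x + B *m u)).
Proof.
move=> PP; have [Ps Pp] := PP; rewrite riccatiE -!addrA lerD2l.
set f := riccati_gain P *m x; set w := u - f.
have -> : u = f + w by rewrite /w addrC subrK.
have -> : E *m (x + B *m (f + w)) = E *m (x + B *m f) + E *m (B *m w).
  by rewrite -mulmxDr mulmxDr addrA.
rewrite (qformD _ _ Ps) -!qform1 (qformD _ _ (trmx1 _ _)).
have crit : bilin 1%:M w f + bilin P (E *m (B *m w)) (E *m (x + B *m f)) = 0.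
  rewrite mulmxA bilin_mull trmx_mul [E *m _]mulmxDr.
  have -> : bilin 1%:M w f = (w^T *m f) ord0 ord0 by rewrite /bilin mulmx1.
  rewrite /bilin.
  have -> : (w^T *m f) ord0 ord0 +
      (w^T *m (B^T *m E^T *m P) *m (E *m x + E *m (B *m f))) ord0 ord0 =
      (w^T *m ((1%:M + B^T *m (E^T *m P *m E) *m B) *m f +
        B^T *m (E^T *m P *m E) *m x)) ord0 ord0.
    rewrite (_ : forall X Y : 'M[R]_(1, 1),
      X ord0 ord0 + Y ord0 ord0 = (X + Y) ord0 ord0);
      last by move=> X Y; rewrite mxE.
    congr (_ ord0 ord0).
    by rewrite mulmxDl mul1mx !mulmxDr !mulmxA addrA addrAC.
  by rewrite /f mulmxA (riccati_normal PP) mulNmx addNr mulmx0 mxE.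
have w0 : 0 <= qform 1%:M w by rewrite qform1 sqn_ge0.
have := Pp (E *m (B *m w)); lra.
Qed.

Lemma riccati_psd P : psd P -> psd (riccati P).
Proof.
move=> [Ps Pp]; split; last first.
  by move=> x; rewrite riccatiE !addr_ge0 ?sqn_ge0.
have tD (X Y : 'M[R]_n) : (X + Y)^T = X^T + Y^T by exact: linearD.
rewrite /riccati; move: (riccati_gain P) => F.
move: (E *m (1%:M + B *m F)) => C.
by rewrite !tD trmx1 !trmx_mul !trmxK Ps mulmxA.
Qed.

Lemma riccati_mono P Q : psd P -> psd Q ->
  (forall x, qform P x <= qform Q x) ->
  forall x, qform (riccati P) x <= qform (riccati Q) x.
Proof.
move=> PP PQ PleQ x.
apply: le_trans (riccati_le x (riccati_gain Q *m x) PP) _.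
by rewrite riccatiE lerD2l.
Qed.

End RiccatiStep.

(** * Stabilization of a periodic discrete-time system *)

Section PeriodicRiccati.
Variables (R : realType) (n m hbar : nat) (E : 'M[R]_n).
Variable B : 'I_hbar -> 'M[R]_(n, m).
Hypothesis hbar_gt0 : (0 < hbar)%N.
Let ph := phase hbar_gt0.

(** The open-loop trajectory of x_(j+1) = E (x_j + B_j u_j). *)
Fixpoint ctraj (x : 'cV[R]_n) (u : nat -> 'cV[R]_m) (j : nat) : 'cV[R]_n :=
  if j is i.+1 then E *m (ctraj x u i + B (ph i) *m u i) else x.

(** The running cost at the step j. *)
Definition cost (x : 'cV[R]_n) (u : nat -> 'cV[R]_m) (j : nat) : R :=
  sqn (ctraj x u j) + sqn (u j).

(** The state x can be steered with a square-summable trajectory and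
    control. *)
Definition finite_cost (x : 'cV[R]_n) : Prop :=
  exists u C, forall L, \sum_(0 <= j < L) cost x u j <= C.

Lemma cost_ge0 x u j : 0 <= cost x u j.
Proof. by rewrite addr_ge0 ?sqn_ge0. Qed.

(** Phase of the step performed with l + 1 steps to go, when the horizon is a
    multiple of the period. *)
Definition back_phase (l : nat) : 'I_hbar := ph (hbar.-1 - l %% hbar).

(** Matrix of the optimal cost over l steps. *)
Fixpoint value_mx (l : nat) : 'M[R]_n :=
  if l is k.+1 then riccati E (B (back_phase k)) (value_mx k) else 0.

Lemma value_mx_psd l : psd (value_mx l).
Proof.
elim: l => [|l IH]; last exact: riccati_psd.
by split; [exact: trmx0 | move=> x; rewrite qform0].
Qed.

Lemma back_phase_period l : back_phase (l + hbar) = back_phase l.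
Proof. by rewrite /back_phase modnDr. Qed.

Lemma back_phaseE N l : (l < N * hbar)%N ->
  back_phase l = ph (N * hbar - l.+1).
Proof.
move=> lN; apply/val_inj => /=.
have lh : (l %% hbar < hbar)%N by rewrite ltn_pmod.
have qN : (l %/ hbar < N)%N by rewrite ltn_divLR.
have -> : (N * hbar - l.+1 =
    (N - (l %/ hbar).+1) * hbar + (hbar.-1 - l %% hbar))%N.
  have {1}-> := divn_eq l hbar.
  move: qN lh; set q := (l %/ hbar)%N; set r := (l %% hbar)%N => qN lh.
  have -> : (N = (N - q.+1) + q.+1)%N by rewrite subnK.
  rewrite addnK mulnDl mulSn; move: ((N - q.+1) * hbar)%N (q * hbar)%N => a b.
  lia.
by rewrite modnMDl.
Qed.

(** No control does better than the optimal one over the last l steps. *)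
Lemma value_le_cost N x u l : (l <= N * hbar)%N ->
  qform (value_mx l) (ctraj x u (N * hbar - l)) <=
  \sum_(N * hbar - l <= j < N * hbar) cost x u j.
Proof.
elim: l => [|l IH] lN; first by rewrite qform0 subn0 big_geq.
have e : (N * hbar - l = (N * hbar - l.+1).+1)%N by rewrite subnSK.
have := IH (ltnW lN); rewrite e => IHe.
rewrite big_ltn; last by rewrite ltn_subrL//= (leq_ltn_trans (leq0n l)).
rewrite /= (back_phaseE lN).
apply: le_trans (riccati_le _ _ _ (u (N * hbar - l.+1)%N) (value_mx_psd l)) _.
by rewrite /cost lerD2l; exact: IHe.
Qed.

Lemma value_mono l x :
  qform (value_mx l) x <= qform (value_mx (l + hbar)) x.
Proof.
elim: l x => [|l IH] x; first by rewrite qform0; exact: (value_mx_psd _).2.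
rewrite addSn /= back_phase_period.
by apply: riccati_mono => //; exact: value_mx_psd.
Qed.

Lemma mxtrace_qform (P : 'M[R]_n) : \tr P = \sum_i qform P (delta_mx i ord0).
Proof. by apply: eq_bigr => i _; rewrite /qform bilin_delta. Qed.

(** A sequence bounded above has increments below any positive number. *)
Lemma small_increment (t : nat -> R) (C eta : R) : 0 < eta ->
  (forall N, t N <= C) -> exists N, t N.+1 - t N <= eta.
Proof.
move=> eta0 tC; apply: contrapT => nex.
have step N : t N + eta <= t N.+1.
  rewrite addrC -lerBrDr leNgt; apply/negP => h.
  by apply: nex; exists N; exact: ltW.
have grow N : t 0%N + N%:R * eta <= t N.
  elim: N => [|N IH]; first by rewrite mul0r addr0.
  by apply: le_trans (step N); rewrite -natr1 mulrDl mul1r addrA lerD2r.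
have [l lC] := archi_nat ((C - t 0%N) / eta + 1).
have := le_trans (grow l) (tC l); rewrite -lerBrDl -ler_pdivlMr//.
by move/(le_trans lC); rewrite gerDl ler10.
Qed.

(** The traces of the optimal costs over N periods increase with N and stay
    bounded, so some increment is small; for positive semidefinite matrices the
    trace controls the quadratic form. *)
Lemma periodic_value_gap : (0 < n)%N -> (forall x, finite_cost x) ->
  exists N, forall x, qform (value_mx (N * hbar + hbar)) x <=
    qform (value_mx (N * hbar)) x + 2^-1 * sqn x.
Proof.
move=> n0 fin.
have bnd (i : 'I_n) : exists C, forall N,
    qform (value_mx (N * hbar)) (delta_mx i ord0) <= C.
  have [u [C uC]] := fin (delta_mx i ord0); exists C => N.
  apply: le_trans (uC (N * hbar)%N).
  have := value_le_cost (delta_mx i ord0) u (leqnn (N * hbar)).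
  by rewrite subnn.
have [C CP] := choice bnd.
have eta0 : 0 < (2^-1 / n%:R : R) by rewrite divr_gt0// ltr0n.
have [N Ngap] : exists N,
    \tr (value_mx (N.+1 * hbar)) - \tr (value_mx (N * hbar)) <= 2^-1 / n%:R.
  apply: (small_increment eta0 (C := \sum_i C i)) => N.
  by rewrite mxtrace_qform; apply: ler_sum => i _.
rewrite mulSn addnC in Ngap.
exists N => x; rewrite -lerBlDl -qformB.
have D : psd (value_mx (N * hbar + hbar) - value_mx (N * hbar)).
  split; first by rewrite (_ : forall X Y : 'M[R]_n, (X - Y)^T = X^T - Y^T);
    [rewrite !(value_mx_psd _).1 | move=> X Y; exact: linearB].
  by move=> y; rewrite qformB subr_ge0 value_mono.
apply: le_trans (psd_le_trace x D) _; rewrite ler_wpM2r ?sqn_ge0//.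
rewrite -ler_pdivlMl ?ltr0n// mulrC.
rewrite (_ : \tr _ = \tr (value_mx (N * hbar + hbar)) -
  \tr (value_mx (N * hbar)))//.
exact: linearB.
Qed.

(** The optimal feedback over one period, followed by a residual cost V which is
    the optimal cost over N periods, makes V decrease by at least |y|^2 / 2 over
    each period, since optimal costs over N and N + 1 periods differ by at most
    |y|^2 / 2. *)
Lemma discrete_stabilization : (0 < n)%N -> (forall x, finite_cost x) ->
  exists (F : 'I_hbar -> 'M[R]_(m, n)) (C g : R), [/\ 0 <= C, 0 < g, g < 1 &
    forall y : nat -> 'cV[R]_n,
      (forall j, y j.+1 = E *m (y j + B (ph j) *m (F (ph j) *m y j))) ->
      forall l, sqn (y (l * hbar)%N) <= C * g ^+ l * sqn (y 0%N)].
Proof.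
move=> n0 fin; have [N gap] := periodic_value_gap n0 fin.
pose V := value_mx (N * hbar).
pose F (k : 'I_hbar) :=
  riccati_gain E (B k) (value_mx (N * hbar + (hbar.-1 - k))).
pose c : R := n%:R * \tr V + 1.
have c1 : 1 <= c.
  rewrite lerDr mulr_ge0// mxtrace_qform; apply: sumr_ge0 => i _.
  exact: (value_mx_psd _).2.
have c0 : 0 < c by exact: lt_le_trans c1.
have Vc x : qform V x <= c * sqn x.
  apply: le_trans (psd_le_trace x (value_mx_psd _)) _.
  by rewrite ler_wpM2r ?sqn_ge0// lerDl.
pose g := 1 - (2 * c)^-1.
have ic : (2 * c)^-1 < 1 by rewrite invf_lt1 ?mulr_gt0//; lra.
exists F, (2 * c), g; split.
- by rewrite mulr_ge0// ltW.
- by rewrite subr_gt0.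
- by rewrite ltrBlDr ltrDl invr_gt0 mulr_gt0.
move=> y yE.
have period l : qform (value_mx (N * hbar + hbar)) (y (l * hbar)%N) >=
    sqn (y (l * hbar)%N) + qform V (y (l.+1 * hbar)%N).
  have step k : (k < hbar)%N ->
      qform (value_mx (N * hbar + (hbar - k))) (y (l * hbar + k)%N) =
      sqn (y (l * hbar + k)%N) + sqn (F (ph k) *m y (l * hbar + k)%N) +
      qform (value_mx (N * hbar + (hbar - k.+1))) (y (l * hbar + k.+1)%N).
    move=> kh; rewrite -(subnSK kh) addnS /= riccatiE.
    have phk : ph (l * hbar + k) = ph k by apply/val_inj; rewrite /= modnMDl.
    have bph : back_phase (N * hbar + (hbar - k.+1)) = ph k.
      rewrite (@back_phaseE N.+1); last first.
        by rewrite mulSn addnC ltn_add2r ltn_subrL/=.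
      apply/val_inj => /=; congr (_ %% _)%N.
      by rewrite mulSn; move: (N * hbar)%N => a; lia.
    have Fk : F (ph k) = riccati_gain E (B (ph k))
        (value_mx (N * hbar + (hbar - k.+1))).
      by rewrite /F /= modn_small// -subn1 -subnDA add1n.
    by rewrite bph -Fk addnS yE phk.
  have tail k : (k <= hbar)%N -> (0 < k)%N ->
      sqn (y (l * hbar)%N) +
        qform (value_mx (N * hbar + (hbar - k))) (y (l * hbar + k)%N) <=
      qform (value_mx (N * hbar + hbar)) (y (l * hbar)%N).
    elim: k => // k IH kh _; case: (posnP k) => [k0|k0].
      have := step 0%N hbar_gt0; rewrite subn0 addn0 k0 => ->.
      by rewrite lerD2r lerDl sqn_ge0.
    apply: le_trans (IH (ltnW kh) k0); rewrite lerD2l (step k kh).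
    by rewrite lerDr addr_ge0 ?sqn_ge0.
  by have := tail hbar (leqnn _) hbar_gt0; rewrite subnn addn0 mulSn addnC.
have decr l : qform V (y (l.+1 * hbar)%N) + 2^-1 * sqn (y (l * hbar)%N) <=
    qform V (y (l * hbar)%N).
  have := le_trans (period l) (gap _); rewrite -/V; lra.
have low l : 2^-1 * sqn (y (l * hbar)%N) <= qform V (y (l * hbar)%N).
  apply: le_trans (decr l); rewrite lerDr; exact: (value_mx_psd _).2.
have geo l : qform V (y (l * hbar)%N) <= g ^+ l * qform V (y 0%N).
  elim: l => [|l IH]; first by rewrite mul0n expr0 mul1r.
  rewrite exprS -mulrA; apply: (@le_trans _ _ (g * qform V (y (l * hbar)%N))).
    rewrite /g mulrBl mul1r lerBrDr; apply: le_trans (decr l); rewrite lerD2l.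
    rewrite invfM -mulrA ler_wpM2l ?invr_ge0// mulrC ler_pdivrMr// mulrC.
    exact: Vc.
  by rewrite ler_wpM2l// subr_ge0 ltW.
move=> l; have := le_trans (low l) (geo l).
rewrite -(ler_pM2l (ltr0n R 2)) mulVKf ?pnatr_eq0// => /le_trans; apply.
have -> : 2 * c * g ^+ l * sqn (y 0%N) = 2 * (g ^+ l * (c * sqn (y 0%N))).
  by ring.
rewrite ler_pM2l// ler_wpM2l ?Vc// exprn_ge0// subr_ge0 ltW//.
Qed.

End PeriodicRiccati.

(** * States of finite cost under sampling *)

Section FiniteCost.
Variables (R : realType) (n' m hbar : nat).
Let n := n'.+1.
Variables (A : 'M[R]_n) (B : 'I_hbar -> 'M[R]_(n, m)).
Hypothesis hbar_gt0 : (0 < hbar)%N.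
Variable d : R.
Hypothesis d_gt0 : 0 < d.

Local Notation traj := (ctraj (expmx A d) B hbar_gt0).
Local Notation fcost := (finite_cost (expmx A d) B hbar_gt0).

Lemma ctraj_lin (a : R) x y u v j :
  traj (a *: x + y) (fun i => a *: u i + v i) j = a *: traj x u j + traj y v j.
Proof.
elim: j => [//|j IH] /=; rewrite IH !mulmxDr -!scalemxAr scalerDr.
by rewrite !addrA; congr (_ + _); rewrite addrAC.
Qed.

Lemma finite_cost_lin (a : R) x y : fcost x -> fcost y -> fcost (a *: x + y).
Proof.
move=> [u [C uC]] [v [D vD]].
exists (fun i => a *: u i + v i), (2 * (a ^+ 2 * C) + 2 * D) => L.
apply: (@le_trans _ _ (
    2 * (a ^+ 2 * \sum_(0 <= j < L) cost (expmx A d) B hbar_gt0 x u j) +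
    2 * \sum_(0 <= j < L) cost (expmx A d) B hbar_gt0 y v j)); last first.
  by rewrite lerD// ler_wpM2l// ler_wpM2l// sqr_ge0.
rewrite !mulr_sumr -big_split/=; apply: ler_sum => j _.
rewrite /cost ctraj_lin.
have := sqnD (a *: traj x u j) (traj y v j); have := sqnD (a *: u j) (v j).
rewrite !sqnZ; lra.
Qed.

Lemma expmx_iter (x : 'cV[R]_n) (j : nat) :
  expmx A (j.+1%:R * d) *m x = expmx A d *m (expmx A (j%:R * d) *m x).
Proof. by rewrite mulmxA -expmxD -natr1 mulrDl mul1r addrC. Qed.

Lemma finite_cost_decaying x : decaying A x -> fcost x.
Proof.
move=> [K [e [e0 xK]]].
have trajE j : traj x (fun=> 0) j = expmx A (j%:R * d) *m x.
  elim: j => [|j IH]; first by rewrite mul0r expmx0 mul1mx.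
  by rewrite /= IH mulmx0 addr0 -expmx_iter.
pose r := expR (- e * d).
have r0 : 0 <= r by exact: expR_ge0.
have r1 : r < 1 by rewrite expR_lt1 mulNr oppr_lt0 mulr_gt0.
have r2 : 0 < 1 - r by rewrite subr_gt0.
have K0 : 0 <= K.
  have := xK 0 (lexx _); rewrite mulr0 expR0 mulr1; exact/le_trans/sqn_ge0.
exists (fun=> 0), (K / (1 - r)) => L.
have : \sum_(0 <= j < L) cost (expmx A d) B hbar_gt0 x (fun=> 0) j <=
    K * (1 - r ^+ L) / (1 - r).
  elim: L => [|L IH]; first by rewrite big_geq// expr0 subrr mulr0 mul0r.
  rewrite big_nat_recr//=.
  have -> : cost (expmx A d) B hbar_gt0 x (fun=> 0) L =
      sqn (expmx A (L%:R * d) *m x).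
    by rewrite /cost sqn0 addr0 trajE.
  have jd : 0 <= L%:R * d by rewrite mulr_ge0// ltW.
  apply: (le_trans (lerD IH (xK _ jd))).
  have -> : expR (- e * (L%:R * d)) = r ^+ L.
    by rewrite mulrCA expRM_natl.
  rewrite exprS -(ler_pM2r r2) mulrDl !divfK ?gt_eqF//.
  by rewrite le_eqVlt; apply/orP; left; apply/eqP; ring.
move=> /le_trans; apply; rewrite ler_pM2r ?invr_gt0//.
by rewrite ler_piMr// gerBl exprn_ge0.
Qed.

(** A single impulse cancels the state at the instant j d. *)
Lemma finite_cost_pulled j (w : 'cV[R]_m) :
  fcost (pulled_input A B hbar_gt0 d j *m w).
Proof.
set x := _ *m w; pose u i := if i == j then - w else 0.
have before i : (i <= j)%N -> traj x u i = expmx A (i%:R * d) *m x.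
  elim: i => [_|i IH ij]; first by rewrite mul0r expmx0 mul1mx.
  by rewrite /= (IH (ltnW ij)) /u (ltn_eqF ij) mulmx0 addr0 -expmx_iter.
have after i : (j < i)%N -> traj x u i = 0.
  elim: i => // i IH; rewrite ltnS leq_eqVlt => /orP[/eqP<-|ji] /=.
    rewrite before// /x /pulled_input !mulmxA -expmxD subrr expmx0 mul1mx.
    by rewrite /u eqxx mulmxN addrN mulmx0.
  by rewrite (IH ji) /u (gtn_eqF ji) mulmx0 addr0 mulmx0.
exists u, (\sum_(0 <= i < j.+1) cost (expmx A d) B hbar_gt0 x u i) => L.
have [Lj|jL] := leqP L j.+1.
  rewrite [leRHS](big_cat_nat _ Lj)//= lerDl; apply: sumr_ge0 => i _.
  exact: cost_ge0.
rewrite (big_cat_nat _ (ltnW jL))//= [X in _ + X](_ : _ = 0) ?addr0//.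
rewrite big_nat_cond big1//.
move=> i /andP[/andP[ji _] _]; rewrite /cost (after _ ji) /u (gtn_eqF ji).
by rewrite !sqn0 addr0.
Qed.

(** A linear form that annihilates the states of finite cost is undetected. *)
Lemma all_finite_cost :
  (forall v, undetected A B hbar_gt0 d v -> v = 0) -> forall x, fcost x.
Proof.
move=> undet x.
have f0 : fcost 0 by apply: finite_cost_decaying; exact: decaying0.
have [N NE] : exists N : 'M[R]_n, forall v, fcost v^T <-> (v <= N)%MS.
  apply: subspace_mx => [|u v fu fv|a v fv]; first by rewrite trmx0.
    by rewrite linearD/= -[u^T]scale1r; exact: finite_cost_lin.
  by rewrite linearZ/= -[_ *: _]addr0; exact: finite_cost_lin.
rewrite -[x]trmxK; apply/NE; rewrite submxE; apply/eqP/rowP => k.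
rewrite [RHS]mxE; set C := cokermx N.
have kill (y : 'cV[R]_n) : fcost y -> (col k C)^T *m y = 0.
  rewrite -{1}[y]trmxK => /NE; rewrite submxE => /eqP yC.
  by rewrite -[y]trmxK -trmx_mul colE mulmxA yC mul0mx trmx0.
have c0 : (col k C)^T = 0.
  apply: undet; split=> [j|y yD]; last exact/kill/finite_cost_decaying.
  apply/rowP => l; rewrite [RHS]mxE.
  have := kill _ (finite_cost_pulled j (delta_mx l ord0)).
  rewrite mulmxA -colE => /(congr1 (fun M : 'M[R]_(1, 1) => M ord0 ord0)).
  by rewrite !mxE.
have : x^T *m col k C = 0 by rewrite -[col k C]trmxK c0 trmx0 mulmx0.
rewrite colE mulmxA -colE.
by move=> /(congr1 (fun M : 'M[R]_(1, 1) => M ord0 ord0)); rewrite !mxE.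
Qed.

End FiniteCost.

(** * From the sampled system to continuous time *)

Section ContinuousTime.
Variables (R : realType) (n m hbar : nat).
Variables (A : 'M[R]_n) (B : 'I_hbar -> 'M[R]_(n, m)).
Variables (F : 'I_hbar -> 'M[R]_(m, n)) (tau : nat -> R) (x : R -> 'cV[R]_n).
Hypothesis hbar_gt0 : (0 < hbar)%N.
Hypothesis Htau : impulse_instants hbar tau.
Hypothesis xsol : closed_loop_solution A B tau F x.

Lemma cvg_coord (T : Type) (G : set_system T) (FG : Filter G) (p q : nat)
    (f : T -> 'M[R]_(p, q)) (l : 'M[R]_(p, q)) i j :
  f @ G --> l -> (fun s => f s i j) @ G --> l i j.
Proof. by move=> fl; exact: cvg_comp fl (@coord_continuous R p q i j l). Qed.

(** The value just after the j-th instant; there is no impulse at t_0 = 0. *)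
Definition post_impulse (j : nat) : 'cV[R]_n :=
  if j is i.+1 then
    x (tau i.+1) +
      B (phase hbar_gt0 i) *m (F (phase hbar_gt0 i) *m x (tau i.+1))
  else x 0.

Lemma post_impulse_cvg j : x s @[s --> (tau j)^'+] --> post_impulse j.
Proof.
case: xsol => _ _ xc xj; case: j => [|j] /=.
  rewrite (tau0 Htau) => P xP.
  have h : within [set s : R | 0 <= s] (nbhs 0) (x @^-1` P).
    apply: (xc 0 (lexx _) _ P xP) => j j0.
    by rewrite lt_eqF// -(tau0 Htau) (tau_lt Htau).
  have : nbhs (0 : R) [set s | 0 <= s -> P (x s)] by exact: h.
  rewrite /= /at_right /within/=.
  by apply: filterS => s sP s0; apply: sP; exact: ltW.
have h := xj j.+1 (phase hbar_gt0 j) isT (thetaE hbar_gt0 (ltn0Sn j)).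
have xE : (fun=> x (tau j.+1)) + (fun s => x s - x (tau j.+1)) = x.
  by apply/funext => s; rewrite fctE addrC subrK.
by have := cvgD (cvg_cst (x (tau j.+1))) h; rewrite xE; exact.
Qed.

(** Between two impulses every solution is a free motion. *)
Lemma solution_segment j (t : R) : tau j < t <= tau j.+1 ->
  x t = expmx A (t - tau j) *m post_impulse j.
Proof.
move=> /andP[jt tj].
pose X s := if s <= tau j then post_impulse j else x s.
have XR s : tau j < s -> X s = x s by rewrite /X leNgt => ->.
have XL : X (tau j) = post_impulse j by rewrite /X lexx.
case: xsol => xd xl xc xj.
have Xd s : tau j < s -> s < t -> is_derive s 1 X (A *m X s).
  move=> js st; rewrite (XR _ js); apply: (@near_eq_is_derive R _ _ x).
    near=> u; rewrite XR//; near: u; exact: lt_nbhsr.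
  apply: xd => [|k]; first by rewrite ltW// (le_lt_trans (tau_ge0 Htau j)).
  apply/eqP => sk; have /(tau_cover_uniq Htau) : tau j < s <= tau j.+1.
    by rewrite js (le_trans (ltW st)).
  case: k sk => [|k] sk.
    by move: js; rewrite sk ltNge (tau_le Htau).
  move=> /(_ k); rewrite sk (tau_lt Htau)// lexx => /(_ isT) jk.
  by move: (lt_le_trans st tj); rewrite sk jk ltxx.
have flow : lin_flow A X (tau j) t.
  move=> i k; split; last first.
    move=> s; rewrite in_itv/= => /andP[js st].
    exact: (is_derive_coord (Xd _ js st)).
  apply/(continuous_within_itvP _ jt); split.
  - move=> s; rewrite in_itv/= => /andP[js st].
    apply: differentiable_continuous; apply/derivable1_diffP.
    by case: (is_derive_coord (Xd _ js st) i k).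
  - rewrite XL; apply: (@cvg_trans _ ((fun s => x s i k) @ (tau j)^'+)).
      apply: near_eq_cvg; near=> s; rewrite XR//; near: s; exact: nbhs_right_gt.
    by apply: cvg_coord; exact: post_impulse_cvg.
  - rewrite (XR _ jt); apply: (@cvg_trans _ ((fun s => x s i k) @ t^'-)).
      apply: near_eq_cvg; near=> s; rewrite XR//; near: s; exact: nbhs_left_gt.
    apply: cvg_coord; apply: xl; exact: le_lt_trans (tau_ge0 Htau j) jt.
by rewrite -(XR _ jt) -XL; exact: flow_expmxE (ltW jt) flow.
Unshelve. all: by end_near. Qed.

End ContinuousTime.

Section Assembly.
Variables (R : realType) (n m hbar : nat).
Variables (A : 'M[R]_n) (B : 'I_hbar -> 'M[R]_(n, m)).
Variables (F : 'I_hbar -> 'M[R]_(m, n)) (d : R).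
Hypothesis hbar_gt0 : (0 < hbar)%N.
Hypothesis d_gt0 : 0 < d.

(** The instants t_j = j d. *)
Definition uniform_instants (j : nat) : R := j%:R * d.

Lemma uniform_impulse_instants : impulse_instants hbar uniform_instants.
Proof.
rewrite /uniform_instants; split=> [|j|j _]; first by rewrite mul0r.
  by rewrite ltr_pM2r// ltr_nat.
by rewrite natrD mulrDl addrC addKr.
Qed.

(** A discrete exponential bound at the beginning of the periods yields the
    exponential bound for all times. *)
Lemma closed_loop_stable_sampled (C g : R) : 0 <= C -> 0 < g -> g < 1 ->
  (forall y : nat -> 'cV[R]_n,
    (forall j, y j.+1 = expmx A d *m (y j +
      B (phase hbar_gt0 j) *m (F (phase hbar_gt0 j) *m y j))) ->
    forall l, sqn (y (l * hbar)%N) <= C * g ^+ l * sqn (y 0%N)) ->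
  closed_loop_stable A B uniform_instants F.
Proof.
move=> C0 g0 g1 decay.
have Ht := uniform_impulse_instants.
have tD j : uniform_instants j.+1 = uniform_instants j + d.
  by rewrite /uniform_instants -natr1 mulrDl mul1r.
pose T := hbar%:R * d; have T0 : 0 < T by rewrite mulr_gt0// ltr0n.
(* The rate is chosen so that g = exp (- 2 mu T). *)
pose mu := - ln g / (2 * T).
have lng : ln g < 0 by rewrite ln_lt0// g0.
have mu0 : 0 < mu by rewrite divr_gt0 ?oppr_gt0// mulr_gt0.
have gE : g = expR (- (2 * mu * T)).
  rewrite /mu (_ : - (2 * (- ln g / (2 * T)) * T) = ln g) ?lnK ?posrE//.
  by field; rewrite gt_eqF.
pose kappa := expR (flow_rate A * d).
have kappa1 : 1 <= kappa.
  by rewrite -expR0 ler_expR mulr_ge0 ?flow_rate_ge0// ltW.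
pose beta := 1 + \sum_k sqn (1%:M + B k *m F k).
have sb k : sqn (1%:M + B k *m F k) <= beta.
  rewrite /beta (bigD1 k)//= addrCA lerDl addr_ge0//.
  by apply: sumr_ge0 => *; exact: sqn_ge0.
have beta1 : 1 <= beta by rewrite lerDl; apply: sumr_ge0 => *; exact: sqn_ge0.
pose kb := kappa * beta.
have kb1 : 1 <= kb by rewrite -[1]mulr1 ler_pM.
have kb0 : 0 < kb by exact: lt_le_trans kb1.
pose K2 := kb ^+ hbar.+1 * (C + 1) * kappa * expR (4 * mu * T).
have K20 : 0 < K2.
  rewrite !mulr_gt0 ?expR_gt0 ?exprn_gt0// ltr_wpDl//.
exists (Num.sqrt K2), mu; split=> //; first by rewrite sqrtr_gt0.
move=> x xsol t t0.
suff main : sqn (x t) <= K2 * expR (- (2 * mu * t)) * sqn (x 0).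
  rewrite -(@ler_pXn2r _ 2)// ?nnegrE ?sqrtr_ge0//; last first.
    by rewrite !mulr_ge0 ?expR_ge0 ?sqrtr_ge0.
  rewrite !exprMn !euclidean_normE sqr_sqrtr ?(ltW K20)//.
  rewrite (_ : expR (- mu * t) ^+ 2 = expR (- (2 * mu * t)))//.
  by rewrite -expRM_natl; congr expR; ring.
have seg := solution_segment hbar_gt0 Ht xsol.
pose post := post_impulse B F uniform_instants x hbar_gt0.
have segle j s : uniform_instants j < s <= uniform_instants j.+1 ->
    sqn (x s) <= kappa * sqn (post j).
  move=> js; have /andP[js1 js2] := js; rewrite (seg _ _ js).
  apply: le_trans (sqn_expmx_le _ _ _) _; first by rewrite subr_ge0 ltW.
  rewrite ler_wpM2r ?sqn_ge0// ler_expR ler_wpM2l ?flow_rate_ge0//.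
  by rewrite lerBlDl -tD.
pose y j := x (uniform_instants j.+1).
have ends j :
    uniform_instants j < uniform_instants j.+1 <= uniform_instants j.+1.
  by rewrite lexx andbT tD ltrDl.
have postE j : post j.+1 =
    y j + B (phase hbar_gt0 j) *m (F (phase hbar_gt0 j) *m y j).
  by [].
have yS j : y j.+1 = expmx A d *m (y j +
    B (phase hbar_gt0 j) *m (F (phase hbar_gt0 j) *m y j)).
  rewrite /y (seg _ _ (ends j.+1)).
  by rewrite [uniform_instants j.+2]tD [_ + d]addrC addrK.
have postle j : sqn (post j.+1) <= beta * sqn (y j).
  rewrite postE mulmxA -[X in X + _]mul1mx -mulmxDl.
  by apply: le_trans (sqn_mulmx _ _) _; rewrite ler_wpM2r ?sqn_ge0.
have after j s : uniform_instants j.+1 < s <= uniform_instants j.+2 ->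
    sqn (x s) <= kb * sqn (y j).
  move=> /segle /le_trans; apply; rewrite /kb -mulrA ler_wpM2l//.
  exact: le_trans kappa1.
have yle l r : sqn (y (l * hbar + r)%N) <= kb ^+ r * sqn (y (l * hbar)%N).
  elim: r => [|r IH]; first by rewrite addn0 expr0 mul1r.
  rewrite addnS exprS -mulrA; apply: le_trans (after _ _ (ends _)) _.
  by rewrite ler_wpM2l// ltW.
have y0le : sqn (y 0%N) <= kappa * sqn (x 0) by exact: (segle 0%N _ (ends 0%N)).
have k0 : 0 <= kappa by exact: le_trans kappa1.
have [t1|t1] := leP t (uniform_instants 1).
  have xt : sqn (x t) <= kappa * sqn (x 0).
    have [->|tn] := eqVneq t 0; first by rewrite ler_peMl ?sqn_ge0.
    apply: (segle 0%N).
    by rewrite /uniform_instants mul0r lt_neqAle eq_sym tn t0.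
  apply: (le_trans xt); rewrite ler_wpM2r ?sqn_ge0//.
  have tT : t <= T.
    apply: (le_trans t1).
    by rewrite /uniform_instants /T ler_wpM2r ?(ltW d_gt0)// ler1n.
  rewrite /K2 -mulrA -expRD -[leLHS]mul1r -[leLHS]mulr1.
  apply: ler_pM => //; first by rewrite mul1r.
    rewrite ler_wpM2r// -[leLHS]mulr1 ler_pM ?exprn_ege1//.
    by rewrite lerDr.
  rewrite -[leLHS]expR0 ler_expR.
  have : 0 <= 2 * mu * (T + (T - t)).
    apply: mulr_ge0; first by rewrite mulr_ge0// ltW.
    by rewrite addr_ge0 ?subr_ge0// ltW.
  by move: (T) => T'; lra.
have tp : 0 < t by rewrite (le_lt_trans _ t1)// mulr_ge0// ltW.
have [[|j] jt] := tau_cover hbar_gt0 Ht tp.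
  by case/andP: jt => _; rewrite leNgt t1.
pose l := (j %/ hbar)%N; pose r := (j %% hbar)%N.
have jE : j = (l * hbar + r)%N by exact: divn_eq.
have rh : (r < hbar)%N by rewrite ltn_pmod.
have tlT : t <= l%:R * T + 2 * T.
  case/andP: jt => _ /le_trans; apply.
  rewrite /uniform_instants /T !mulrA -mulrDl.
  rewrite ler_wpM2r ?(ltW d_gt0)// -!natrM -natrD ler_nat jE.
  by rewrite -!addnS leq_add2l mul2n -addnn -addn1 leq_add.
apply: le_trans (after _ _ jt) _; rewrite jE.
apply: (@le_trans _ _ (kb * (kb ^+ r * (C * g ^+ l * (kappa * sqn (x 0)))))).
  rewrite ler_wpM2l ?(ltW kb0)//; apply: (le_trans (yle _ _)).
  rewrite ler_wpM2l ?exprn_ge0 ?(ltW kb0)//; apply: (le_trans (decay y yS l)).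
  by rewrite ler_wpM2l// mulr_ge0// exprn_ge0// ltW.
have gl : g ^+ l <= expR (4 * mu * T) * expR (- (2 * mu * t)).
  rewrite gE -expRM_natl -expRD ler_expR.
  have : 0 <= 2 * mu * (l%:R * T + 2 * T - t).
    by apply: mulr_ge0; [rewrite mulr_ge0// ltW | rewrite subr_ge0].
  move: (l%:R) => L; lra.
have kr : kb * kb ^+ r <= kb ^+ hbar.+1.
  by rewrite -exprS; apply: ler_weXn2l => //; exact: ltnW.
have -> : kb * (kb ^+ r * (C * g ^+ l * (kappa * sqn (x 0)))) =
    (kb * kb ^+ r) * C * g ^+ l * (kappa * sqn (x 0)) by ring.
have -> : K2 * expR (- (2 * mu * t)) * sqn (x 0) =
    kb ^+ hbar.+1 * (C + 1) * (expR (4 * mu * T) * expR (- (2 * mu * t))) *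
    (kappa * sqn (x 0)) by rewrite /K2; ring.
have kbr0 : 0 <= kb * kb ^+ r by rewrite -exprS exprn_ge0// ltW.
rewrite ler_wpM2r ?mulr_ge0 ?sqn_ge0//.
apply: ler_pM => //; first by rewrite mulr_ge0.
  by rewrite exprn_ge0// ltW.
by apply: ler_pM => //; rewrite lerDl.
Qed.

End Assembly.

(** * The equivalence *)

Section Sufficiency.
Variables (R : realType) (n' m hbar : nat).
Let n := n'.+1.
Variables (A : 'M[R]_n) (B : 'I_hbar -> 'M[R]_(n, m)).

Lemma hautus_stabilizable : (0 < hbar)%N ->
  (forall lambda : R[i], (spectrum A `&` closed_right_half_plane) lambda ->
     \rank (hautus_matrix A B lambda) = n) ->
  pair_stabilizable A B.
Proof.
move=> h0 hautus; have [d d0 und] := exists_sampling h0 hautus.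
have [F [C [g [C0 g0 g1 decay]]]] :=
  discrete_stabilization (ltn0Sn n') (all_finite_cost d0 und).
exists (uniform_instants d); split; first exact: uniform_impulse_instants.
by exists F; exact: closed_loop_stable_sampled decay.
Qed.

End Sufficiency.

Theorem theorem1p2 (R : realType) (n m hbar : nat)
    (n_gt0 : (0 < n)%N) (m_gt0 : (0 < m)%N) (hbar_gt0 : (0 < hbar)%N)
    (A : 'M[R]_n) (B : 'I_hbar -> 'M[R]_(n, m)) :
  [<-> (* (i) *) pair_stabilizable A B;
       (* (ii) *) forall lambda : R[i], closed_right_half_plane lambda ->
         \rank (hautus_matrix A B lambda) = n;
       (* (iii) *) forall lambda : R[i],
         (spectrum A `&` closed_right_half_plane) lambda ->
         \rank (hautus_matrix A B lambda) = n].
Proof.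
tfae.
- by move=> stab lambda; exact: stabilizable_hautus.
- by move=> hautus lambda [_ ?]; exact: hautus.
- by case: n n_gt0 A B => // n' _ A' B'; exact: hautus_stabilizable.
Qed.
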